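(* Let $\vec u$ be the solution of the boundary value problem $L\vec u=\vec f$ on $(0,1)$, $\vec u(0)=\vec l$, $\vec u(1)=\vec r$, and let $\vec U$ be the solution of the discrete problem $L^N\vec U(x_j)=\vec f(x_j)$ for $1\le j\le N-1$, $\vec U(x_0)=\vec l$, $\vec U(x_N)=\vec r$, on the Shishkin mesh $\overline\Omega^N$. Then there is a constant $C>0$, independent of $\varepsilon_1,\varepsilon_2$ and $N$, such that $$\|\vec u-\vec U\|_{\overline\Omega^N}\le C N^{-1}\ln N .$$
   Context: Setting. $\Omega=(0,1)$, $\overline\Omega=[0,1]$; $0<\varepsilon_1<\varepsilon_2\le 1$ are (small) parameters. $E=\mathrm{diag}(\varepsilon_1,\varepsilon_2)$, $A(x)=\mathrm{diag}(a_1(x),a_2(x))$, $B(x)=\begin{bmatrix} b_{11}(x)&-b_{12}(x)\\-b_{21}(x)&b_{22}(x)\end{bmatrix}$, $\vec f=(f_1,f_2)^T$, with $a_i,b_{ij},f_i$ sufficiently smooth on $\overline\Omega$ and, for constants $\alpha,\beta>0$ and all $x\in\overline\Omega$, $a_i(x)\ge\alpha>0$, $b_{ii}(x)-b_{ij}(x)\ge\beta>0$, $b_{ij}(x)>0$ for $i,j\in\{1,2\}$, $i\ne j$. $\vec l,\vec r\in\mathbb R^2$ are given. The functions $a_i,b_{ij},f_i$, the vectors $\vec l,\vec r$ and the constants $\alpha,\beta$ do not depend on $\varepsilon_1,\varepsilon_2,N$. The operator is $L\vec u(x)=E\vec u''(x)+A(x)\vec u'(x)-B(x)\vec u(x)$.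 Shishkin mesh. $N$ is a positive multiple of $4$. Put $\tau_2=\min\{\tfrac12,\tfrac{2\varepsilon_2}{\alpha}\ln N\}$, $\tau_1=\min\{\tfrac{\tau_2}{2},\tfrac{2\varepsilon_1}{\alpha}\ln N\}$, $H_1=4\tau_1/N$, $H_2=4(\tau_2-\tau_1)/N$, $H_3=2(1-\tau_2)/N$. The mesh $\overline\Omega^N=\{x_j\}_{j=0}^N$ is $x_j=jH_1$ for $0\le j\le N/4$, $x_j=\tau_1+(j-\tfrac N4)H_2$ for $N/4\le j\le N/2$, $x_j=\tau_2+(j-\tfrac N2)H_3$ for $N/2\le j\le N$. Difference operators. $h_j=x_j-x_{j-1}$, $\overline h_j=(h_j+h_{j+1})/2$, $D^+Y(x_j)=\frac{Y(x_{j+1})-Y(x_j)}{h_{j+1}}$, $D^-Y(x_j)=\frac{Y(x_j)-Y(x_{j-1})}{h_j}$, $\delta^2Y(x_j)=\frac{1}{\overline h_j}(D^+Y(x_j)-D^-Y(x_j))$, acting componentwise on vector mesh functions, and $L^N\vec U(x_j)=E\delta^2\vec U(x_j)+A(x_j)D^+\vec U(x_j)-B(x_j)\vec U(x_j)$ for $1\le j\le N-1$. For a vector mesh function $\vec Z=(Z_1,Z_2)^T$, $\|\vec Z\|_{\overline\Omega^N}=\max_{i=1,2}\max_{0\le j\le N}|Z_i(x_j)|$; a function on $[0,1]$ is restricted to the mesh. *)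

(* Defs.v *)
From Stdlib Require Import Reals PeanoNat.
From Coquelicot Require Import Coquelicot.
Open Scope R_scope.

Inductive index2 : Set := fst_ix | snd_ix.

Definition other (i : index2) : index2 := match i with fst_ix => snd_ix | snd_ix => fst_ix end.

Definition diag (d : index2 -> R) (i j : index2) : R :=
  match i, j with fst_ix, fst_ix => d fst_ix | snd_ix, snd_ix => d snd_ix | _, _ => 0 end.

Definition mulmv (M : index2 -> index2 -> R) (v : index2 -> R) (i : index2) : R :=
  M i fst_ix * v fst_ix + M i snd_ix * v snd_ix.

(* The off-diagonal entries of B carry a minus sign, so that b itself is
   entrywise positive. *)
Definition matB (b : index2 -> index2 -> R -> R) (x : R) (i j : index2) : R :=
  match i, j with
  | fst_ix, fst_ix => b fst_ix fst_ix x
  | fst_ix, snd_ix => - b fst_ix snd_ix x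
  | snd_ix, fst_ix => - b snd_ix fst_ix x
  | snd_ix, snd_ix => b snd_ix snd_ix x
  end.

Definition Icc01 (x : R) : Prop := 0 <= x <= 1.
Definition Ioo01 (x : R) : Prop := 0 < x < 1.

(* C^k([0,1]): d m is the m-th derivative on (0,1), extended continuously to
   [0,1].  Values of g outside [0,1] play no role. *)
Definition Ck_Icc01 (k : nat) (g : R -> R) : Prop :=
  exists d : nat -> R -> R,
    d 0%nat = g /\
    (forall m, (m <= k)%nat -> continuous_on Icc01 (d m)) /\
    (forall m x, (m < k)%nat -> Ioo01 x -> is_derive (d m) x (d (S m) x)).

Definition opL (eps : index2 -> R) (a : index2 -> R -> R)
    (b : index2 -> index2 -> R -> R)
    (u : index2 -> R -> R) (x : R) (i : index2) : R :=
  mulmv (diag eps) (fun j => Derive_n (u j) 2 x) i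
  + mulmv (diag (fun j => a j x)) (fun j => Derive (u j) x) i
  - mulmv (matB b x) (fun j => u j x) i.

(* A classical solution, continuous on [0,1] and twice differentiable on (0,1).
   ex_derive_n (u i) 2 only speaks of the total function Derive (u i), hence the
   separate ex_derive.  Continuity of the second derivatives on (0,1) follows
   from the equation. *)
Definition bvp_solution (eps : index2 -> R) (a : index2 -> R -> R)
    (b : index2 -> index2 -> R -> R) (f : index2 -> R -> R) (l r : index2 -> R)
    (u : index2 -> R -> R) : Prop :=
  (forall i, continuous_on Icc01 (u i)) /\
  (forall i x, Ioo01 x -> ex_derive (u i) x /\ ex_derive_n (u i) 2 x) /\
  (forall i x, Ioo01 x -> opL eps a b u x i = f i x) /\
  (forall i, u i 0 = l i) /\
  (forall i, u i 1 = r i).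

Definition tau2 (alpha : R) (eps : index2 -> R) (N : nat) : R :=
  Rmin (1 / 2) (2 * eps snd_ix / alpha * ln (INR N)).

Definition tau1 (alpha : R) (eps : index2 -> R) (N : nat) : R :=
  Rmin (tau2 alpha eps N / 2) (2 * eps fst_ix / alpha * ln (INR N)).

Definition mesh (alpha : R) (eps : index2 -> R) (N : nat) (j : nat) : R :=
  let t1 := tau1 alpha eps N in
  let t2 := tau2 alpha eps N in
  let H1 := 4 * t1 / INR N in
  let H2 := 4 * (t2 - t1) / INR N in
  let H3 := 2 * (1 - t2) / INR N in
  if (4 * j <=? N)%nat then INR j * H1
  else if (2 * j <=? N)%nat then t1 + (INR j - INR N / 4) * H2
  else t2 + (INR j - INR N / 2) * H3.

(* In the difference operators x is a mesh j |-> x_j and Y a mesh function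
   j |-> Y(x_j); step x j is meaningful for 1 <= j. *)
Definition step (x : nat -> R) (j : nat) : R := x j - x (pred j).

Definition Dplus (x Y : nat -> R) (j : nat) : R :=
  (Y (S j) - Y j) / step x (S j).

Definition Dminus (x Y : nat -> R) (j : nat) : R :=
  (Y j - Y (pred j)) / step x j.

Definition delta2 (x Y : nat -> R) (j : nat) : R :=
  1 / ((step x j + step x (S j)) / 2) * (Dplus x Y j - Dminus x Y j).

Definition opLN (x : nat -> R) (eps : index2 -> R) (a : index2 -> R -> R)
    (b : index2 -> index2 -> R -> R) (U : index2 -> nat -> R)
    (j : nat) (i : index2) : R :=
  mulmv (diag eps) (fun k => delta2 x (U k) j) i
  + mulmv (diag (fun k => a k (x j))) (fun k => Dplus x (U k) j) i
  - mulmv (matB b (x j)) (fun k => U k j) i.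

Definition discrete_solution (x : nat -> R) (N : nat) (eps : index2 -> R)
    (a : index2 -> R -> R) (b : index2 -> index2 -> R -> R) (f : index2 -> R -> R)
    (l r : index2 -> R) (U : index2 -> nat -> R) : Prop :=
  (forall i j, (1 <= j <= N - 1)%nat -> opLN x eps a b U j i = f i (x j)) /\
  (forall i, U i 0%nat = l i) /\
  (forall i, U i N = r i).

Definition mesh_norm (N : nat) (Z : index2 -> nat -> R) : R :=
  Rmax (Rmax_N (fun j => Rabs (Z fst_ix j)) N) (Rmax_N (fun j => Rabs (Z snd_ix j)) N).

(* Main.v *)
Require Import Defs.
From Stdlib Require Import Reals PeanoNat Lra Lia.
From Coquelicot Require Import Coquelicot.
Open Scope R_scope.

(** Write w_i = u_i'. Component i of the equation says that the flux eps_i w_i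
    obeys the scalar first-order equation eps_i w_i' + a_i w_i = g_i with
    g_i = f_i + b_ii u_i - b_ij u_j. The maximum principle bounds u, hence g_i,
    and comparison for this equation gives
    |w_i(x)| <= C (1 + eps_i^(-1) exp (- alpha x / eps_i)) ([layer_bound]).
    So at the level of first derivatives every component sees only its own layer,
    and the weak coupling never mixes the two scales. All increments are measured by
    one majorant
    V(x) = x - exp (- alpha x / eps_1) - exp (- alpha x / eps_2), which grows by a
    bounded amount over [0,1] and, by the choice of the transition points, by at
    most delta = O(N^(-1) ln N) over each mesh cell ([shishkin_layer_increment]).

    The truncation error of the scheme is not small pointwise near the layers, but
    it is small in a negative norm: hbar_j times the error at x_j is
    F_(j+1) - F_j with max |F| = O(delta) ([truncation_flux]). Indeed
    eps_i D^- u_i(x_j) is a value of the flux inside the cell by the mean value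
    theorem, and the flux itself is an antiderivative of g_i - a_i w_i, which the
    scheme merely integrates by a quadrature rule.

    The scalar convective operator eps delta^2 + a D^+ turns such right-hand sides
    into mesh functions psi with |psi| <= C max |F|, uniformly in eps
    ([flux_stability]): in terms of D^- psi it is a first-order recursion, and
    summation by parts against 1/a removes the factor 1/eps. With psi_i absorbing
    the truncation error of component i, the remainder u - U - psi solves the full
    discrete system with the bounded data B psi and zero boundary values, so the
    discrete maximum principle finishes the proof ([system_error]). *)

(** * Mean value and maximum arguments on a segment *)

(** Composing with this retraction of the line onto [a,b] turns continuity relative
    to [a,b] into continuity everywhere, as the classical theorems demand. *)
Definition clamp (a b t : R) : R := Rmax a (Rmin b t).

Lemma clamp_in (a b t : R) : a <= b -> a <= clamp a b t <= b.
Proof.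
  intros H; unfold clamp, Rmax, Rmin; repeat destruct Rle_dec; lra.
Qed.

Lemma clamp_id (a b t : R) : a <= t <= b -> clamp a b t = t.
Proof.
  intros H; unfold clamp, Rmax, Rmin; repeat destruct Rle_dec; lra.
Qed.

Lemma clamp_dist (a b s t : R) :
  a <= b -> Rabs (clamp a b s - clamp a b t) <= Rabs (s - t).
Proof.
  intros H; unfold clamp, Rmax, Rmin; repeat destruct Rle_dec;
    unfold Rabs; repeat destruct Rcase_abs; lra.
Qed.

Lemma continuous_comp_clamp (a b : R) (f : R -> R) (t : R) :
  a <= b -> continuous_on (fun x => a <= x <= b) f ->
  continuous (fun x => f (clamp a b x)) t.
Proof.
  intros Hab Hf.
  assert (Hc := Hf (clamp a b t) (clamp_in a b t Hab)).
  intros P HP; destruct (Hc P HP) as [d Hd].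
  exists d; intros y Hy; apply Hd; [|now apply clamp_in].
  apply Rle_lt_trans with (2 := Hy); now apply clamp_dist.
Qed.

Lemma segment_max (a b : R) (f : R -> R) :
  a <= b -> continuous_on (fun x => a <= x <= b) f ->
  exists y, a <= y <= b /\ forall x, a <= x <= b -> f x <= f y.
Proof.
  intros Hab Hf.
  destruct (continuity_ab_maj (fun x => f (clamp a b x)) a b Hab) as [y [Hy1 Hy2]].
  { intros c _; apply continuity_pt_filterlim; now apply continuous_comp_clamp. }
  exists y; split; [exact Hy2|].
  intros x Hx; specialize (Hy1 x Hx); now rewrite !clamp_id in Hy1.
Qed.

Lemma mean_value (a b : R) (f df : R -> R) :
  a < b -> continuous_on (fun x => a <= x <= b) f ->
  (forall x, a < x < b -> is_derive f x (df x)) ->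
  exists c, a < c < b /\ f b - f a = df c * (b - a).
Proof.
  intros Hab Hf Hd.
  set (g := fun x => f (clamp a b x)).
  assert (Hg : forall x, a < x < b -> derivable_pt_lim g x (df x)).
  { intros x Hx; apply is_derive_Reals.
    apply is_derive_ext_loc with f; [|now apply Hd].
    assert (He : 0 < Rmin (x - a) (b - x)) by (apply Rmin_pos; lra).
    exists (mkposreal _ He); intros y Hy.
    change (Rabs (y - x) < Rmin (x - a) (b - x)) in Hy.
    assert (H1 := Rmin_l (x - a) (b - x)); assert (H2 := Rmin_r (x - a) (b - x)).
    apply Rabs_def2 in Hy; unfold g; rewrite clamp_id; [reflexivity|lra]. }
  destruct (MVT g id a b (fun c Hc => exist _ (df c) (Hg c Hc))
              (fun c _ => derivable_pt_id c) Hab) as [c [Hc E]].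
  { intros c _; apply continuity_pt_filterlim; apply continuous_comp_clamp; [lra|auto]. }
  { intros c _; apply derivable_continuous_pt, derivable_pt_id. }
  exists c; split; [exact Hc|].
  rewrite derive_pt_id in E; simpl in E; unfold id, g in E.
  rewrite !clamp_id in E by lra; lra.
Qed.

Lemma continuous_on_plus (D : R -> Prop) (f g : R -> R) :
  continuous_on D f -> continuous_on D g -> continuous_on D (fun x => f x + g x).
Proof.
  intros Hf Hg x Hx.
  apply (filterlim_comp_2 (G := locally (f x)) (H := locally (g x)) f g Rplus);
    [now apply Hf|now apply Hg|exact (filterlim_plus (f x) (g x))].
Qed.

Lemma continuous_on_scal (D : R -> Prop) (c : R) (f : R -> R) :
  continuous_on D f -> continuous_on D (fun x => c * f x).
Proof.
  intros Hf x Hx; apply (filterlim_comp _ _ _ f (Rmult c) _ (locally (f x)));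
    [now apply Hf|exact (filterlim_scal_r c (f x))].
Qed.

(** Both G - f and G + f have nonnegative derivatives. This plays the
    role of bounding |f b - f a| by the integral of |f'|. *)
Lemma increment_dominated (a b : R) (f df G dG : R -> R) :
  a <= b ->
  continuous_on (fun x => a <= x <= b) f -> continuous_on (fun x => a <= x <= b) G ->
  (forall x, a < x < b -> is_derive f x (df x)) ->
  (forall x, a < x < b -> is_derive G x (dG x)) ->
  (forall x, a < x < b -> Rabs (df x) <= dG x) ->
  Rabs (f b - f a) <= G b - G a.
Proof.
  intros [Hab|<-] Cf CG Df DG Hle; [|rewrite !Rminus_diag, Rabs_R0; lra].
  destruct (mean_value a b (fun x => G x + -1 * f x) (fun x => dG x + -1 * df x) Hab)
    as [c [Hc Ec]].
  { apply continuous_on_plus; [exact CG|now apply continuous_on_scal]. }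
  { intros x Hx; apply (is_derive_plus G (fun x => -1 * f x)); [auto|].
    apply is_derive_scal; auto. }
  destruct (mean_value a b (fun x => G x + f x) (fun x => dG x + df x) Hab)
    as [d [Hd Ed]].
  { now apply continuous_on_plus. }
  { intros x Hx; apply (is_derive_plus G f); auto. }
  assert (Bc := proj1 (Rabs_le_between _ _) (Hle c Hc)).
  assert (Bd := proj1 (Rabs_le_between _ _) (Hle d Hd)).
  apply Rabs_le_between.
  assert (0 <= (dG c + -1 * df c) * (b - a)) by (apply Rmult_le_pos; lra).
  assert (0 <= (dG d + df d) * (b - a)) by (apply Rmult_le_pos; lra).
  lra.
Qed.

Lemma is_derive_continuous_on (a b : R) (f df : R -> R) :
  (forall x, a <= x <= b -> is_derive f x (df x)) ->
  continuous_on (fun x => a <= x <= b) f.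
Proof.
  intros H; apply continuous_on_forall; intros x Hx.
  apply (ex_derive_continuous f); exists (df x); auto.
Qed.

Lemma derive_nonneg_at_left_max (f : R -> R) (x y l : R) :
  x < y -> (forall t, x < t < y -> f t <= f y) -> is_derive f y l -> 0 <= l.
Proof.
  intros Hxy Hmax Hd; apply is_derive_Reals in Hd.
  destruct (Rle_or_lt 0 l) as [H|H]; [exact H|exfalso].
  destruct (Hd (- l)) as [d Hd']; [lra|].
  set (h := Rmin (d / 2) ((y - x) / 2)).
  assert (Hd0 := cond_pos d).
  assert (0 < h) by (apply Rmin_pos; lra).
  assert (h <= d / 2) by apply Rmin_l.
  assert (h <= (y - x) / 2) by apply Rmin_r.
  assert (B : Rabs ((f (y + - h) - f y) / - h - l) < - l).
  { apply Hd'; [lra|]. rewrite Rabs_Ropp, Rabs_pos_eq; lra. }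
  apply Rabs_def2 in B.
  assert (f (y + - h) <= f y) by (apply Hmax; lra).
  assert (0 <= (f (y + - h) - f y) / - h); [|lra].
  replace ((f (y + - h) - f y) / - h) with ((f y - f (y + - h)) / h) by (field; lra).
  apply Rdiv_le_0_compat; lra.
Qed.

(** If the second derivative l were positive, f' would be positive just to the right
    of x and the mean value theorem would push f above its maximum. *)
Lemma interior_max_derivatives (a b : R) (f df : R -> R) (x l : R) :
  a < x < b -> (forall t, a < t < b -> f t <= f x) ->
  (forall t, a < t < b -> is_derive f t (df t)) -> is_derive df x l ->
  df x = 0 /\ l <= 0.
Proof.
  intros Hx Hmax Hf Hdf.
  assert (H1 : 0 <= df x).
  { apply derive_nonneg_at_left_max with f a x; [lra| |apply Hf; lra].
    intros t Ht; apply Hmax; lra. }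
  assert (H2 : 0 <= - df x).
  { (* reflecting t to - t turns the right neighbourhood into a left one *)
    apply derive_nonneg_at_left_max with (fun t => f (- t)) (- b) (- x); [lra| |].
    - intros t Ht; rewrite Ropp_involutive; apply Hmax; lra.
    - replace (- df x) with (scal (-1) (df x)) by (unfold scal; simpl; unfold mult; simpl; ring).
      apply (is_derive_comp f Ropp).
      + rewrite Ropp_involutive; apply Hf; lra.
      + auto_derive; [trivial|ring]. }
  assert (E : df x = 0) by lra.
  split; [exact E|].
  apply Rnot_lt_le; intros Hl; apply is_derive_Reals in Hdf.
  destruct (Hdf l Hl) as [d Hd].
  assert (Hd0 := cond_pos d).
  set (h := Rmin (d / 2) ((b - x) / 2)).
  assert (0 < h) by (apply Rmin_pos; lra).
  assert (h <= d / 2) by apply Rmin_l.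
  assert (h <= (b - x) / 2) by apply Rmin_r.
  destruct (mean_value x (x + h) f df) as [c [Hc Ec]]; [lra| | |].
  { apply is_derive_continuous_on with df; intros t Ht; apply Hf; lra. }
  { intros t Ht; apply Hf; lra. }
  assert (B : Rabs ((df (x + (c - x)) - df x) / (c - x) - l) < l).
  { apply Hd; [lra|]. rewrite Rabs_pos_eq; lra. }
  apply Rabs_def2 in B; replace (x + (c - x)) with c in B by ring; rewrite E in B.
  assert (P : 0 < (df c - 0) / (c - x)) by lra.
  assert (0 < df c).
  { replace (df c) with ((df c - 0) / (c - x) * (c - x)) by (field; lra).
    apply Rmult_lt_0_compat; lra. }
  assert (f (x + h) <= f x) by (apply Hmax; lra).
  assert (0 < df c * (x + h - x)) by (apply Rmult_lt_0_compat; lra).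
  lra.
Qed.

Lemma increment_le_majorant (K a b : R) (f df V dV : R -> R) :
  a <= b -> continuous_on (fun x => a <= x <= b) f ->
  (forall t, is_derive V t (dV t)) ->
  (forall x, a < x < b -> is_derive f x (df x)) ->
  (forall x, a < x < b -> Rabs (df x) <= K * dV x) ->
  Rabs (f b - f a) <= K * (V b - V a).
Proof.
  intros Hab Cf DV Df Hle; rewrite Rmult_minus_distr_l.
  apply (increment_dominated a b f df (fun t => K * V t) (fun t => K * dV t)); auto.
  - apply is_derive_continuous_on with (fun t => K * dV t).
    intros; now apply is_derive_scal.
  - intros; now apply is_derive_scal.
Qed.

Lemma length_le_majorant (a b : R) (V dV : R -> R) :
  a <= b -> (forall t, is_derive V t (dV t)) -> (forall t, 1 <= dV t) ->
  b - a <= V b - V a.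
Proof.
  intros Hab DV V1; apply Rle_trans with (1 := Rle_abs _).
  rewrite <- (Rmult_1_l (V b - V a)).
  apply (increment_le_majorant 1 a b (fun t => t) (fun _ => 1) V dV); auto.
  - apply is_derive_continuous_on with (fun _ => 1); intros; apply (@is_derive_id R_AbsRing).
  - intros; apply (@is_derive_id R_AbsRing).
  - intros x _; rewrite Rabs_R1, Rmult_1_l; auto.
Qed.

(** * Bounds for a scalar convection-diffusion equation *)

Definition C1_bounded (M : R) (g : R -> R) : Prop :=
  continuous_on Icc01 g /\ (forall x, Icc01 x -> Rabs (g x) <= M) /\
  exists dg, forall x, Ioo01 x -> is_derive g x (dg x) /\ Rabs (dg x) <= M.

Lemma C1_bounded_le (M M' : R) (g : R -> R) :
  M <= M' -> C1_bounded M g -> C1_bounded M' g.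
Proof.
  intros H [H1 [H2 [dg H3]]]; split; [exact H1|split].
  - intros x Hx; specialize (H2 x Hx); lra.
  - exists dg; intros x Hx; destruct (H3 x Hx) as [H4 H5]; split; [exact H4|lra].
Qed.

Lemma continuous_on_bounded (g : R -> R) :
  continuous_on Icc01 g -> exists M, forall x, Icc01 x -> Rabs (g x) <= M.
Proof.
  intros Hg.
  destruct (segment_max 0 1 g) as [y [_ Hy]]; [lra|exact Hg|].
  destruct (segment_max 0 1 (fun x => -1 * g x)) as [z [_ Hz]];
    [lra|now apply continuous_on_scal|].
  exists (Rmax (g y) (-1 * g z)); intros x Hx; apply Rabs_le_between.
  specialize (Hy x Hx); specialize (Hz x Hx); simpl in Hz.
  assert (H1 := Rmax_l (g y) (-1 * g z)); assert (H2 := Rmax_r (g y) (-1 * g z)); lra.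
Qed.

Lemma Ck_C1_bounded (g : R -> R) : Ck_Icc01 1 g -> exists M, C1_bounded M g.
Proof.
  intros [d [<- [Hc Hd]]].
  destruct (continuous_on_bounded (d 0%nat)) as [M0 H0]; [apply Hc; lia|].
  destruct (continuous_on_bounded (d 1%nat)) as [M1 H1]; [apply Hc; lia|].
  exists (Rmax M0 M1); split; [apply Hc; lia|split].
  - intros x Hx; apply Rle_trans with (1 := H0 x Hx), Rmax_l.
  - exists (d 1%nat); intros x Hx; split; [apply Hd; [lia|exact Hx]|].
    assert (Hx' : Icc01 x) by (unfold Ioo01, Icc01 in *; lra).
    apply Rle_trans with (1 := H1 x Hx'), Rmax_r.
Qed.

Lemma Icc01_subset_continuous (a b : R) (f : R -> R) :
  0 <= a -> b <= 1 -> continuous_on Icc01 f -> continuous_on (fun x => a <= x <= b) f.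
Proof.
  intros Ha Hb; apply continuous_on_subset; intros x Hx; unfold Icc01; lra.
Qed.

Lemma is_derive_linear (K x : R) : is_derive (fun t => K * t) x K.
Proof. auto_derive; [trivial|ring]. Qed.

Lemma increment_le_length (K a b : R) (f df : R -> R) :
  a <= b -> continuous_on (fun x => a <= x <= b) f ->
  (forall x, a < x < b -> is_derive f x (df x)) ->
  (forall x, a < x < b -> Rabs (df x) <= K) ->
  Rabs (f b - f a) <= K * (b - a).
Proof.
  intros Hab Cf Df Hle.
  apply (increment_le_majorant K a b f df (fun t => t) (fun _ => 1)); auto.
  - intros; apply (@is_derive_id R_AbsRing).
  - intros; rewrite Rmult_1_r; auto.
Qed.

Lemma C1_bounded_lipschitz (M : R) (g : R -> R) (x y : R) :
  C1_bounded M g -> 0 <= x -> x <= y -> y <= 1 -> Rabs (g y - g x) <= M * (y - x).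
Proof.
  intros [Hc [_ [dg Hd]]] Hx Hxy Hy.
  apply (increment_le_length M x y g dg Hxy).
  - now apply Icc01_subset_continuous.
  - intros t Ht; apply Hd; unfold Ioo01; lra.
  - intros t Ht; apply Hd; unfold Ioo01; lra.
Qed.

Lemma bounded_derivative_increment (K : R) (f df : R -> R) (x y : R) :
  0 <= K -> (forall t, Ioo01 t -> is_derive f t (df t) /\ Rabs (df t) <= K) ->
  Ioo01 x -> Ioo01 y -> Rabs (f y - f x) <= K.
Proof.
  intros HK Hd.
  assert (Hle : forall s t, Ioo01 s -> Ioo01 t -> s <= t -> Rabs (f t - f s) <= K).
  { intros s t Hs Ht Hst; unfold Ioo01 in *.
    apply Rle_trans with (K * (t - s)).
    - apply (increment_le_length K s t f df Hst).
      + apply is_derive_continuous_on with df; intros; apply Hd; lra.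
      + intros; apply Hd; lra.
      + intros; apply Hd; lra.
    - rewrite <- (Rmult_1_r K) at 2; apply Rmult_le_compat_l; lra. }
  intros Hx Hy; destruct (Rle_or_lt x y); [auto|].
  rewrite Rabs_minus_sym; apply Hle; auto; lra.
Qed.

Lemma Rabs_mult_le (x y A B : R) : Rabs x <= A -> Rabs y <= B -> Rabs (x * y) <= A * B.
Proof.
  intros; rewrite Rabs_mult; apply Rmult_le_compat; auto using Rabs_pos.
Qed.

(** The derivative of eps w + a u is g + a' u, which is bounded, so eps w + a u varies
    by a bounded amount. At the point c where w(c) = u(1) - u(0) it is itself
    bounded. *)
Lemma flux_bound (eps M M0 G : R) (a g u w : R -> R) :
  0 < eps <= 1 -> C1_bounded M a -> continuous_on Icc01 u ->
  (forall x, Ioo01 x -> is_derive u x (w x)) ->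
  (forall x, Ioo01 x -> is_derive w x ((g x - a x * w x) / eps)) ->
  (forall x, Icc01 x -> Rabs (u x) <= M0) ->
  (forall x, Ioo01 x -> Rabs (g x) <= G) ->
  forall x, Ioo01 x -> eps * Rabs (w x) <= 2 * M0 + 3 * (M * M0) + G.
Proof.
  intros He [Ca [Ba [da Da]]] Cu Du Dw Bu Bg x Hx.
  assert (HI : forall t, Ioo01 t -> Icc01 t) by (unfold Ioo01, Icc01; intros; lra).
  destruct (mean_value 0 1 u w) as [c [Hc Ec]]; [lra|exact Cu|auto|].
  assert (Hinc : Rabs ((eps * w x + a x * u x) - (eps * w c + a c * u c)) <= G + M * M0).
  { apply (bounded_derivative_increment _ (fun t => eps * w t + a t * u t)
             (fun t => g t + da t * u t)); auto.
    - apply Rle_trans with (Rabs (g x) + Rabs (da x) * Rabs (u x)).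
      + assert (H := Rabs_pos (g x)); assert (H' := Rabs_pos (da x));
        assert (H'' := Rabs_pos (u x)); nra.
      + apply Rplus_le_compat; [auto|].
        apply Rmult_le_compat; auto using Rabs_pos; now apply Da.
    - intros t Ht; split.
      + evar_last.
        * apply (is_derive_plus (fun t => eps * w t) (fun t => a t * u t)).
          { apply is_derive_scal; now apply Dw. }
          apply (is_derive_mult a u); [now apply Da|now apply Du|].
          intros; apply Rmult_comm.
        * unfold plus, mult, scal; simpl; unfold mult; simpl; field; lra.
      + apply Rle_trans with (1 := Rabs_triang _ _), Rplus_le_compat; [auto|].
        apply Rabs_mult_le; [now apply Da|auto]. }
  assert (Hax := Rabs_mult_le _ _ _ _ (Ba x (HI x Hx)) (Bu x (HI x Hx))).
  assert (Hac := Rabs_mult_le _ _ _ _ (Ba c (HI c Hc)) (Bu c (HI c Hc))).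
  assert (H0 := Bu 0 ltac:(unfold Icc01; lra)); assert (H1 := Bu 1 ltac:(unfold Icc01; lra)).
  assert (Hwc : Rabs (eps * w c) <= 1 * (2 * M0)).
  { apply Rabs_mult_le; [rewrite Rabs_pos_eq; lra|].
    replace (w c) with (u 1 - u 0) by lra.
    unfold Rabs in *; repeat destruct Rcase_abs; lra. }
  rewrite <- (Rabs_pos_eq eps) by lra; rewrite <- Rabs_mult.
  unfold Rabs in *; repeat destruct Rcase_abs; lra.
Qed.

(** Comparison with the supersolution m on the right-hand side: m dominates w on
    (0, eps/alpha] by the crude bound eps w <= W0, and a later positive maximum of
    w - m would contradict eps (w - m)' + a (w - m) <= 0. *)
Lemma layer_upper_bound (eps alpha G W0 : R) (a g w : R -> R) :
  0 < eps -> 0 < alpha -> 0 <= G -> 0 <= W0 ->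
  (forall x, Ioo01 x -> alpha <= a x) ->
  (forall x, Ioo01 x -> is_derive w x ((g x - a x * w x) / eps)) ->
  (forall x, Ioo01 x -> g x <= G) ->
  (forall x, Ioo01 x -> eps * w x <= W0) ->
  forall x, Ioo01 x -> w x <= G / alpha + 3 * W0 / eps * exp (- (alpha * x / eps)).
Proof.
  intros He Hal HG HW Ha Dw Bg Bw x Hx.
  set (m := fun t => G / alpha + 3 * W0 / eps * exp (- (alpha * t / eps))).
  set (dm := fun t => - (alpha / eps) * (3 * W0 / eps * exp (- (alpha * t / eps)))).
  assert (Dm : forall t, is_derive m t (dm t)).
  { intros t; unfold m, dm; auto_derive; [trivial|]. unfold Rdiv; ring. }
  assert (HGa : 0 <= G / alpha) by (apply Rdiv_le_0_compat; lra).
  assert (HWe : 0 <= W0 / eps) by (apply Rdiv_le_0_compat; lra).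
  (* on (0, eps/alpha] the exponential is at least exp (-1) >= 1/3; this is where the
     factor 3 in the statement comes from *)
  assert (Hnear : forall t, Ioo01 t -> t <= eps / alpha -> w t <= m t).
  { intros t Ht Hts; unfold m.
    assert (E : alpha * t / eps <= 1).
    { apply Rle_div_l; [lra|]. apply Rle_div_r in Hts; [lra|lra]. }
    assert (1 / 3 <= exp (- (alpha * t / eps))).
    { apply Rle_trans with (exp (- (1))).
      - rewrite exp_Ropp; assert (H := exp_le_3); assert (H' := exp_pos 1).
        unfold Rdiv; rewrite Rmult_1_l; now apply Rinv_le_contravar.
      - destruct E as [E|E]; [left; apply exp_increasing; lra|rewrite E; lra]. }
    assert (w t <= W0 / eps) by (apply Rle_div_r; [lra|]; specialize (Bw t Ht); lra).
    replace (3 * W0 / eps) with (3 * (W0 / eps)) by (field; lra).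
    nra. }
  change (w x <= m x).
  destruct (Rle_or_lt x (eps / alpha)) as [Hxs|Hxs]; [auto|].
  apply Rnot_lt_le; intros Hgt.
  set (s := eps / alpha) in *.
  assert (Hs : 0 < s) by (apply Rdiv_lt_0_compat; lra).
  unfold Ioo01 in *.
  destruct (segment_max s x (fun t => w t + -1 * m t)) as [y [Hy Hmax]]; [lra| |].
  { apply continuous_on_plus; [|apply continuous_on_scal].
    - apply is_derive_continuous_on with (fun t => (g t - a t * w t) / eps).
      intros; apply Dw; lra.
    - apply is_derive_continuous_on with dm; auto. }
  assert (Hxy := Hmax x ltac:(lra)); simpl in Hxy.
  assert (Hsy : s < y).
  { destruct (proj1 Hy) as [H|H]; [exact H|exfalso].
    assert (w s <= m s) by (apply Hnear; lra). rewrite <- H in Hxy; lra. }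
  assert (Hl : 0 <= (g y - a y * w y) / eps + -1 * dm y).
  { apply (derive_nonneg_at_left_max (fun t => w t + -1 * m t) s y); [exact Hsy| |].
    - intros t Ht; apply Hmax; lra.
    - apply (is_derive_plus w (fun t => -1 * m t)); [apply Dw; lra|].
      apply is_derive_scal, Dm. }
  assert (Hy01 : 0 < y < 1) by lra.
  assert (Hneg : (g y - a y * w y) / eps + -1 * dm y < 0).
  { set (q := 3 * W0 / eps * exp (- (alpha * y / eps))).
    assert (Hq : 0 <= q).
    { apply Rmult_le_pos; [|left; apply exp_pos].
      replace (3 * W0 / eps) with (3 * (W0 / eps)) by (field; lra); lra. }
    assert (Em : m y = G / alpha + q) by reflexivity.
    replace ((g y - a y * w y) / eps + -1 * dm y)
      with ((g y - a y * w y + alpha * q) / eps) by (unfold dm, q; field; lra).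
    apply Rdiv_neg_pos; [|lra].
    specialize (Ha y Hy01); specialize (Bg y Hy01).
    assert (G = alpha * (G / alpha)) by (field; lra).
    nra. }
  lra.
Qed.

Lemma layer_bound (eps alpha G W0 : R) (a g w : R -> R) :
  0 < eps -> 0 < alpha -> 0 <= G -> 0 <= W0 ->
  (forall x, Ioo01 x -> alpha <= a x) ->
  (forall x, Ioo01 x -> is_derive w x ((g x - a x * w x) / eps)) ->
  (forall x, Ioo01 x -> Rabs (g x) <= G) ->
  (forall x, Ioo01 x -> eps * Rabs (w x) <= W0) ->
  forall x, Ioo01 x ->
  Rabs (w x) <= G / alpha + 3 * W0 / eps * exp (- (alpha * x / eps)).
Proof.
  intros He Hal HG HW Ha Dw Bg Bw x Hx.
  assert (Hup : w x <= G / alpha + 3 * W0 / eps * exp (- (alpha * x / eps))).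
  { apply (layer_upper_bound eps alpha G W0 a g w); auto; intros t Ht.
    - apply Rle_trans with (1 := Rle_abs _); auto.
    - apply Rle_trans with (2 := Bw t Ht), Rmult_le_compat_l; [lra|apply Rle_abs]. }
  assert (Hlo : -1 * w x <= G / alpha + 3 * W0 / eps * exp (- (alpha * x / eps))).
  { apply (layer_upper_bound eps alpha G W0 a (fun t => -1 * g t) (fun t => -1 * w t));
      auto; intros t Ht.
    - evar_last; [apply is_derive_scal, Dw, Ht|]. field; lra.
    - specialize (Bg t Ht); apply Rabs_le_between in Bg; lra.
    - apply Rle_trans with (2 := Bw t Ht), Rmult_le_compat_l; [lra|].
      unfold Rabs; destruct Rcase_abs; lra. }
  unfold Rabs; destruct Rcase_abs; lra.
Qed.

(** * Maximum principles for the continuous and the discrete system *)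

Lemma mulmv_diag (d v : index2 -> R) (i : index2) : mulmv (diag d) v i = d i * v i.
Proof. unfold mulmv, diag; destruct i; ring. Qed.

Lemma mulmv_matB (b : index2 -> index2 -> R -> R) (x : R) (v : index2 -> R) (i : index2) :
  mulmv (matB b x) v i = b i i x * v i - b i (other i) x * v (other i).
Proof. unfold mulmv, matB; destruct i; simpl; ring. Qed.

(** Where m is the largest modulus over both components, the row sum condition makes
    the zeroth-order term act like beta times m, whatever the other component is. *)
Lemma coupling_at_max (beta bd bo m v : R) :
  beta <= bd - bo -> 0 < bo -> 0 <= m -> Rabs v <= m -> beta * m <= bd * m - bo * v.
Proof.
  intros Hb Ho Hm Hv; assert (v <= m) by (apply Rle_trans with (2 := Hv), Rle_abs); nra.
Qed.

(** The sign sg records whether the largest modulus is attained as a maximum or as a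
    minimum of the component. *)
Lemma system_max (u : index2 -> R -> R) :
  (forall i, continuous_on Icc01 (u i)) ->
  exists i sg y, (sg = 1 \/ sg = -1) /\ Icc01 y /\
    forall j x, Icc01 x -> Rabs (u j x) <= sg * u i y.
Proof.
  intros Hu.
  assert (H1 : forall i, exists sg y, (sg = 1 \/ sg = -1) /\ Icc01 y /\
    forall x, Icc01 x -> Rabs (u i x) <= sg * u i y).
  { intros i.
    destruct (segment_max 0 1 (u i)) as [y [Hy Hmy]]; [lra|apply Hu|].
    destruct (segment_max 0 1 (fun x => -1 * u i x)) as [z [Hz Hmz]];
      [lra|apply continuous_on_scal, Hu|].
    destruct (Rle_or_lt (-1 * u i z) (u i y)).
    - exists 1, y; repeat split; auto; try apply Hy; intros x Hx.
      specialize (Hmy x Hx); specialize (Hmz x Hx); simpl in Hmz; apply Rabs_le_between; lra.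
    - exists (-1), z; repeat split; auto; try apply Hz; intros x Hx.
      specialize (Hmy x Hx); specialize (Hmz x Hx); simpl in Hmz; apply Rabs_le_between; lra. }
  destruct (H1 fst_ix) as [s [y [Hs [Hy Hm]]]], (H1 snd_ix) as [s' [y' [Hs' [Hy' Hm']]]].
  destruct (Rle_or_lt (s * u fst_ix y) (s' * u snd_ix y')).
  - exists snd_ix, s', y'; split; [auto|split; [auto|]].
    intros [|] x Hx; [apply Rle_trans with (1 := Hm x Hx); lra|auto].
  - exists fst_ix, s, y; split; [auto|split; [auto|]].
    intros [|] x Hx; [auto|apply Rle_trans with (1 := Hm' x Hx); lra].
Qed.

(** At an interior point where the largest modulus over both components is attained,
    the derivative terms have the favourable sign and the equation leaves
    beta m <= |f|. *)
Lemma bvp_solution_bound (beta Fm Rm : R) (eps : index2 -> R) (a : index2 -> R -> R)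
    (b : index2 -> index2 -> R -> R) (f : index2 -> R -> R) (l r : index2 -> R)
    (u : index2 -> R -> R) :
  0 < beta -> 0 <= Fm -> 0 <= Rm -> (forall i, 0 < eps i) ->
  (forall i x, Icc01 x -> beta <= b i i x - b i (other i) x) ->
  (forall i x, Icc01 x -> 0 < b i (other i) x) ->
  (forall i x, Icc01 x -> Rabs (f i x) <= Fm) ->
  (forall i, Rabs (l i) <= Rm) -> (forall i, Rabs (r i) <= Rm) ->
  bvp_solution eps a b f l r u ->
  forall i x, Icc01 x -> Rabs (u i x) <= Rm + Fm / beta.
Proof.
  intros Hbeta HF HR He Hb Ho Hf Hl Hr [Cu [Du [Eq [Ul Ur]]]] i x Hx.
  destruct (system_max u Cu) as [k [s [y [Hs [Hy Hmax]]]]].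
  apply Rle_trans with (1 := Hmax i x Hx).
  assert (HFb : 0 <= Fm / beta) by (apply Rdiv_le_0_compat; lra).
  assert (Hsle : forall t, s * t <= Rabs t).
  { intros t; unfold Rabs; destruct Rcase_abs, Hs; subst; lra. }
  destruct (proj1 Hy) as [Hy0|Hy0].
  2: { rewrite <- Hy0, Ul; apply Rle_trans with (1 := Hsle _); specialize (Hl k); lra. }
  destruct (proj2 Hy) as [Hy1|Hy1].
  2: { rewrite Hy1, Ur; apply Rle_trans with (1 := Hsle _); specialize (Hr k); lra. }
  assert (Hy01 : Ioo01 y) by (split; lra).
  destruct (interior_max_derivatives 0 1 (fun t => s * u k t) (fun t => s * Derive (u k) t)
    y (s * Derive_n (u k) 2 y)) as [E1 E2]; [exact Hy01| | | |].
  { intros t Ht; apply Rle_trans with (1 := Hsle _), Hmax; unfold Icc01; lra. }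
  { intros t Ht; apply is_derive_scal, Derive_correct; exact (proj1 (Du k t Ht)). }
  { apply is_derive_scal, Derive_correct; exact (proj2 (Du k y Hy01)). }
  specialize (Eq k y Hy01); unfold opL in Eq.
  rewrite !mulmv_diag, mulmv_matB in Eq.
  set (m := s * u k y) in *.
  assert (Hm : 0 <= m) by (apply Rle_trans with (2 := Hmax k y Hy), Rabs_pos).
  assert (Hv : Rabs (s * u (other k) y) <= m).
  { replace (Rabs (s * u (other k) y)) with (Rabs (u (other k) y)); [auto|].
    rewrite Rabs_mult; destruct Hs; subst s; [rewrite Rabs_R1|rewrite Rabs_m1]; ring. }
  assert (HB := coupling_at_max beta _ _ m _ (Hb k y Hy) (Ho k y Hy) Hm Hv).
  assert (Hrhs : s * - f k y <= Fm).
  { apply Rle_trans with (1 := Hsle _); rewrite Rabs_Ropp; auto. }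
  assert (b k k y * m - b k (other k) y * (s * u (other k) y)
    = eps k * (s * Derive_n (u k) 2 y) + a k y * (s * Derive (u k) y) + s * - f k y).
  { unfold m; rewrite <- Eq; ring. }
  rewrite E1 in H; specialize (He k).
  assert (eps k * (s * Derive_n (u k) 2 y) <= 0) by nra.
  clearbody m; assert (m <= Fm / beta) by (apply Rle_div_r; lra).
  lra.
Qed.

Lemma nat_argmax (g : nat -> R) (N : nat) :
  exists j, (j <= N)%nat /\ forall k, (k <= N)%nat -> g k <= g j.
Proof.
  induction N as [|N [j [Hj Hm]]].
  - exists 0%nat; split; [lia|]; intros k Hk; replace k with 0%nat by lia; lra.
  - destruct (Rle_or_lt (g j) (g (S N))) as [H|H].
    + exists (S N); split; [lia|]; intros k Hk.
      destruct (Nat.eq_dec k (S N)) as [->|]; [lra|].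
      apply Rle_trans with (2 := H), Hm; lia.
    + exists j; split; [lia|]; intros k Hk.
      destruct (Nat.eq_dec k (S N)) as [->|]; [lra|apply Hm; lia].
Qed.

Lemma discrete_max_principle (beta P : R) (x : nat -> R) (N : nat) (eps : index2 -> R)
    (a : index2 -> R -> R) (b : index2 -> index2 -> R -> R) (Y : index2 -> nat -> R) :
  0 < beta -> 0 <= P -> (forall i, 0 < eps i) ->
  (forall j, (1 <= j <= N)%nat -> 0 < step x j) ->
  (forall i j, (j <= N)%nat -> 0 <= a i (x j)) ->
  (forall i j, (j <= N)%nat -> beta <= b i i (x j) - b i (other i) (x j)) ->
  (forall i j, (j <= N)%nat -> 0 < b i (other i) (x j)) ->
  (forall i j, (1 <= j <= N - 1)%nat -> Rabs (opLN x eps a b Y j i) <= P) ->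
  (forall i, Y i 0%nat = 0) -> (forall i, Y i N = 0) ->
  forall i j, (j <= N)%nat -> Rabs (Y i j) <= P / beta.
Proof.
  intros Hbeta HP He Hx Ha Hb Ho HL Y0 YN i j Hj.
  assert (Hmax : exists k n, (n <= N)%nat /\
    forall i j, (j <= N)%nat -> Rabs (Y i j) <= Rabs (Y k n)).
  { destruct (nat_argmax (fun j => Rabs (Y fst_ix j)) N) as [p [Hp Hpm]].
    destruct (nat_argmax (fun j => Rabs (Y snd_ix j)) N) as [q [Hq Hqm]].
    destruct (Rle_or_lt (Rabs (Y fst_ix p)) (Rabs (Y snd_ix q))).
    - exists snd_ix, q; split; [auto|]; intros [|] k Hk; [|auto].
      apply Rle_trans with (1 := Hpm k Hk); auto.
    - exists fst_ix, p; split; [auto|]; intros [|] k Hk; [auto|].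
      apply Rle_trans with (1 := Hqm k Hk); lra. }
  destruct Hmax as [k [n [Hn Hmax]]].
  apply Rle_trans with (1 := Hmax i j Hj).
  assert (HPb : 0 <= P / beta) by (apply Rdiv_le_0_compat; lra).
  destruct (Nat.eq_dec n 0) as [->|]; [rewrite Y0, Rabs_R0; auto|].
  destruct (Nat.eq_dec n N) as [->|]; [rewrite YN, Rabs_R0; auto|].
  set (m := Rabs (Y k n)) in *.
  assert (Hs : exists s, (s = 1 \/ s = -1) /\ m = s * Y k n).
  { unfold m, Rabs; destruct Rcase_abs; [exists (-1)|exists 1]; split; auto; ring. }
  destruct Hs as [s [Hs Em]].
  assert (Hsle : forall t, s * t <= Rabs t).
  { intros t; unfold Rabs; destruct Rcase_abs, Hs; subst; lra. }
  assert (Hm : 0 <= m) by apply Rabs_pos.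
  assert (Hv : Rabs (s * Y (other k) n) <= m).
  { replace (Rabs (s * Y (other k) n)) with (Rabs (Y (other k) n)); [apply Hmax; lia|].
    rewrite Rabs_mult; destruct Hs; subst s; [rewrite Rabs_R1|rewrite Rabs_m1]; ring. }
  assert (HB := coupling_at_max beta _ _ m _ (Hb k n Hn) (Ho k n Hn) Hm Hv).
  assert (HLk := HL k n ltac:(lia)); unfold opLN in HLk.
  rewrite !mulmv_diag, mulmv_matB in HLk.
  rewrite <- Rabs_Ropp in HLk; apply (Rle_trans _ _ _ (Hsle _)) in HLk.
  assert (h1 := Hx n ltac:(lia)); assert (h2 := Hx (S n) ltac:(lia)).
  assert (Hp : s * Dplus x (Y k) n <= 0).
  { unfold Dplus.
    replace (s * ((Y k (S n) - Y k n) / step x (S n)))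
      with (- ((m - s * Y k (S n)) / step x (S n))) by (rewrite Em; field; lra).
    assert (s * Y k (S n) <= m) by (apply Rle_trans with (1 := Hsle _), Hmax; lia).
    assert (0 <= (m - s * Y k (S n)) / step x (S n)) by (apply Rdiv_le_0_compat; lra).
    lra. }
  assert (Hd : 0 <= s * Defs.Dminus x (Y k) n).
  { unfold Defs.Dminus.
    replace (s * ((Y k n - Y k (pred n)) / step x n))
      with ((m - s * Y k (pred n)) / step x n) by (rewrite Em; field; lra).
    assert (s * Y k (pred n) <= m) by (apply Rle_trans with (1 := Hsle _), Hmax; lia).
    apply Rdiv_le_0_compat; lra. }
  assert (H2 : s * delta2 x (Y k) n <= 0).
  { unfold delta2.
    assert (0 < 1 / ((step x n + step x (S n)) / 2)) by (apply Rdiv_lt_0_compat; lra).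
    nra. }
  specialize (He k); specialize (Ha k n Hn).
  assert (eps k * (s * delta2 x (Y k) n) <= 0) by nra.
  assert (a k (x n) * (s * Dplus x (Y k) n) <= 0) by nra.
  rewrite Em in HB at 2; apply Rle_div_r; lra.
Qed.

(** * Stability of the discrete convection operator in a negative norm *)

Definition hbar (x : nat -> R) (j : nat) : R := (step x j + step x (S j)) / 2.

(** The function s counts the places where the step changes: it may stay
    constant across equal neighbouring steps, and its total variation is what the discrepancy between
    hbar_j and h_(j+1) costs. On a Shishkin mesh it jumps by one at each transition
    point. *)
Definition tame_mesh (x : nat -> R) (N : nat) (s : nat -> R) : Prop :=
  x 0%nat = 0 /\ x N = 1 /\
  (forall j, (1 <= j <= N)%nat -> 0 < step x j) /\
  (forall j, (1 <= j < N)%nat ->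
     Rabs (step x (S j) - step x j) <= (s (S j) - s j) * step x (S j)) /\
  (forall j, 0 <= s j <= 2).

Lemma abs_telescope (Z P : nat -> R) (m n : nat) :
  (m <= n)%nat ->
  (forall k, (m <= k < n)%nat -> Rabs (Z (S k) - Z k) <= P (S k) - P k) ->
  Rabs (Z n - Z m) <= P n - P m.
Proof.
  intros Hmn; induction Hmn as [|n Hmn IH]; intros H.
  - rewrite !Rminus_diag, Rabs_R0; lra.
  - assert (H1 := IH (fun k Hk => H k ltac:(lia))); assert (H2 := H n ltac:(lia)).
    replace (Z (S n) - Z m) with ((Z (S n) - Z n) + (Z n - Z m)) by ring.
    apply Rle_trans with (1 := Rabs_triang _ _); lra.
Qed.

Lemma tame_mesh_mono (x s : nat -> R) (N m n : nat) :
  tame_mesh x N s -> (m <= n <= N)%nat -> x m <= x n.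
Proof.
  intros [_ [_ [H _]]] [Hmn HnN]; induction Hmn as [|n Hmn IH]; [lra|].
  specialize (IH ltac:(lia)); specialize (H (S n) ltac:(lia)); unfold step in H; simpl in H; lra.
Qed.

Lemma tame_mesh_range (x s : nat -> R) (N j : nat) :
  tame_mesh x N s -> (j <= N)%nat -> Icc01 (x j).
Proof.
  intros T Hj; assert (H0 := tame_mesh_mono x s N 0 j T ltac:(lia)).
  assert (H1 := tame_mesh_mono x s N j N T ltac:(lia)).
  destruct T as [E0 [E1 _]]; rewrite E0 in H0; rewrite E1 in H1; now split.
Qed.

Fixpoint mesh_sum (x v : nat -> R) (j : nat) : R :=
  match j with 0%nat => 0 | S k => mesh_sum x v k + step x (S k) * v (S k) end.

Lemma Dplus_mesh_sum (x v : nat -> R) (j : nat) :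
  step x (S j) <> 0 -> Dplus x (mesh_sum x v) j = v (S j).
Proof. intros H; unfold Dplus; simpl; field; exact H. Qed.

Lemma Dminus_mesh_sum (x v : nat -> R) (j : nat) :
  (1 <= j)%nat -> step x j <> 0 -> Defs.Dminus x (mesh_sum x v) j = v j.
Proof. intros Hj H; destruct j; [lia|]; unfold Defs.Dminus; simpl; field; exact H. Qed.

(** With v = D^- psi, the equation eps (v_(j+1) - v_j) + a_j hbar_j v_(j+1)
    = F_(j+1) - F_j becomes, for q = eps v - F and rho_j = a_j hbar_j / eps, the
    recursion q_(j+1) (1 + rho_j) = q_j - rho_j F_(j+1). Each step is a convex
    combination of q_j and - F_(j+1), which is why q inherits the bound of F. *)
Fixpoint flux_response (rho F : nat -> R) (j : nat) : R :=
  match j with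
  | 0%nat => 0
  | S k => (flux_response rho F k - rho k * F (S k)) / (1 + rho k)
  end.

(** The homogeneous solution of the same recursion, a discrete boundary layer. *)
Fixpoint flux_decay (rho : nat -> R) (j : nat) : R :=
  match j with 0%nat => 1 | S k => flux_decay rho k / (1 + rho k) end.

Lemma flux_response_bound (rho F : nat -> R) (N : nat) (Phi : R) :
  0 <= Phi -> (forall k, (k < N)%nat -> 0 <= rho k) ->
  (forall k, (1 <= k <= N)%nat -> Rabs (F k) <= Phi) ->
  forall k, (k <= N)%nat -> Rabs (flux_response rho F k) <= Phi.
Proof.
  intros HP Hr HF; induction k as [|k IH]; intros Hk; simpl.
  - rewrite Rabs_R0; exact HP.
  - specialize (IH ltac:(lia)); specialize (Hr k ltac:(lia)); specialize (HF (S k) ltac:(lia)).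
    apply Rabs_le_between in IH; apply Rabs_le_between in HF; apply Rabs_le_between.
    split; [apply Rle_div_r|apply Rle_div_l]; try lra; nra.
Qed.

(** The particular solution y has slopes (F + q) / eps, which are of size 1/eps, but
    hbar_k v_(k+1) = (q_k - q_(k+1)) / a_k: the slopes are themselves differences.
    Hence y + q / a varies only through the variation of 1/a and the jumps of the step
    size. A multiple of the monotone homogeneous solution then restores the value 0
    at the right end at the cost of a factor 2. *)
Lemma flux_stability (x s : nat -> R) (N : nat) (eps alpha M Phi : R) (a F : nat -> R) :
  tame_mesh x N s -> (2 <= N)%nat -> 0 < eps -> 0 < alpha -> 0 <= M -> 0 <= Phi ->
  (forall j, (j <= N)%nat -> alpha <= a j) ->
  (forall j, (1 <= j < N)%nat -> Rabs (a (S j) - a j) <= M * step x (S j)) ->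
  F 1%nat = 0 -> (forall j, (1 <= j <= N)%nat -> Rabs (F j) <= Phi) ->
  exists psi, psi 0%nat = 0 /\ psi N = 0 /\
    (forall j, (1 <= j < N)%nat ->
       eps * delta2 x psi j + a j * Dplus x psi j = (F (S j) - F j) / hbar x j) /\
    (forall j, (j <= N)%nat -> Rabs (psi j) <= 2 * (M / (alpha * alpha) + 5 / alpha) * Phi).
Proof.
  intros T HN He Hal HM HPhi Ha Ha' F1 HF.
  assert (T' := T); destruct T' as [X0 [XN [Hh [Hs Hs2]]]].
  set (rho := fun k => a k * hbar x k / eps).
  assert (Hhb : forall k, (k < N)%nat -> 0 < hbar x k).
  { intros k Hk; unfold hbar; specialize (Hh (S k) ltac:(lia)) as h2.
    destruct k; [replace (step x 0) with 0 by (unfold step; simpl; ring); lra|].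
    specialize (Hh (S k) ltac:(lia)) as h1; lra. }
  assert (Hrho : forall k, (k < N)%nat -> 0 < rho k).
  { intros k Hk; unfold rho; apply Rdiv_lt_0_compat; [|lra].
    apply Rmult_lt_0_compat; [|auto]. specialize (Ha k ltac:(lia)); lra. }
  set (q := flux_response rho F); set (p := flux_decay rho).
  assert (Hq : forall k, (k <= N)%nat -> Rabs (q k) <= Phi).
  { apply flux_response_bound; auto; intros; left; auto. }
  (* F 1 = 0 makes the recursion start at index 1 whatever rho 0 is *)
  assert (q1 : q 1%nat = 0).
  { unfold q; simpl; rewrite F1; unfold Rdiv; ring. }
  assert (qS : forall k, (k < N)%nat -> q (S k) * (1 + rho k) = q k - rho k * F (S k)).
  { intros k Hk; specialize (Hrho k Hk); unfold q; simpl; field; lra. }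
  assert (pS : forall k, (k < N)%nat -> p (S k) * (1 + rho k) = p k).
  { intros k Hk; specialize (Hrho k Hk); unfold p; simpl; field; lra. }
  assert (Hp : forall k, (k <= N)%nat -> 0 < p k).
  { induction k as [|k IH]; intros Hk; unfold p; simpl; [lra|].
    apply Rdiv_lt_0_compat; [apply IH; lia|]. specialize (Hrho k ltac:(lia)); lra. }
  set (v := fun k => (F k + q k) / eps).
  set (y := mesh_sum x v); set (pi := mesh_sum x p).
  set (c := fun k => / a k).
  assert (Hc : forall k, (k <= N)%nat -> 0 < c k <= / alpha).
  { intros k Hk; specialize (Ha k Hk); unfold c; split;
      [apply Rinv_0_lt_compat; lra|apply Rinv_le_contravar; lra]. }
  assert (hv : forall k, (k < N)%nat -> hbar x k * v (S k) = c k * (q k - q (S k))).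
  { intros k Hk; specialize (qS k Hk); specialize (Ha k ltac:(lia)).
    assert (Eq : q k - q (S k) = rho k * (F (S k) + q (S k))) by lra.
    rewrite Eq; unfold c, v, rho; field; lra. }
  (* Z telescopes with increments controlled by those of P; the factor 2 in front of s
     comes from |q_k - q_(k+1)| <= 2 Phi *)
  set (Z := fun k => y k + c k * q k).
  set (P := fun k => Phi * (M / (alpha * alpha) * x k + 2 / alpha * s k)).
  assert (HZ : forall k, (1 <= k < N)%nat -> Rabs (Z (S k) - Z k) <= P (S k) - P k).
  { intros k Hk.
    assert (h1 := Hh k ltac:(lia)); assert (h2 := Hh (S k) ltac:(lia)).
    assert (Hb := Hhb k ltac:(lia)).
    assert (EZ : Z (S k) - Z k = (c (S k) - c k) * q (S k)
      + (step x (S k) - step x k) * (/ (2 * hbar x k)) * (c k * (q k - q (S k)))).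
    { rewrite <- hv by lia; unfold Z; unfold y at 1; simpl; fold y.
      replace (c (S k) * q (S k)) with
        ((c (S k) - c k) * q (S k) + c k * q k - c k * (q k - q (S k))) by ring.
      rewrite <- hv by lia.
      replace (step x (S k)) with (hbar x k + (step x (S k) - step x k) / 2) at 1
        by (unfold hbar; field).
      field; lra. }
    assert (B1 : Rabs (c (S k) - c k) <= M * step x (S k) / (alpha * alpha)).
    { assert (A1 := Ha k ltac:(lia)); assert (A2 := Ha (S k) ltac:(lia)).
      replace (c (S k) - c k) with ((a k - a (S k)) * (c (S k) * c k))
        by (unfold c; field; lra).
      unfold Rdiv; rewrite Rinv_mult; apply Rabs_mult_le.
      - rewrite Rabs_minus_sym; auto.
      - apply Rabs_mult_le; rewrite Rabs_pos_eq; try apply Hc; try lia;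
          left; apply Hc; lia. }
    assert (B2 : Rabs (/ (2 * hbar x k)) <= / step x (S k)).
    { rewrite Rabs_pos_eq by (left; apply Rinv_0_lt_compat; lra).
      apply Rinv_le_contravar; [lra|]. unfold hbar; lra. }
    assert (B3 : Rabs (c k * (q k - q (S k))) <= / alpha * (2 * Phi)).
    { apply Rabs_mult_le.
      - rewrite Rabs_pos_eq; [|left]; apply Hc; lia.
      - apply Rle_trans with (1 := Rabs_triang _ _); rewrite Rabs_Ropp.
        assert (H1 := Hq k ltac:(lia)); assert (H2 := Hq (S k) ltac:(lia)); lra. }
    rewrite EZ; apply Rle_trans with (1 := Rabs_triang _ _).
    apply Rle_trans with (M * step x (S k) / (alpha * alpha) * Phi
      + (s (S k) - s k) * step x (S k) * / step x (S k) * (/ alpha * (2 * Phi))).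
    - apply Rplus_le_compat; [apply Rabs_mult_le; auto; apply Hq; lia|].
      apply Rabs_mult_le; [apply Rabs_mult_le; auto|auto].
    - right; unfold P; replace (x (S k)) with (x k + step x (S k)) by (unfold step; simpl; ring).
      field; lra. }
  set (K := (M / (alpha * alpha) + 5 / alpha) * Phi).
  assert (Hia : 0 < / alpha) by now apply Rinv_0_lt_compat.
  assert (HMa : 0 <= M / (alpha * alpha)) by (apply Rdiv_le_0_compat; nra).
  assert (HK : 0 <= K) by (unfold K, Rdiv at 2; apply Rmult_le_pos; [nra|auto]).
  assert (Hy : forall k, (k <= N)%nat -> Rabs (y k) <= K).
  { intros k Hk; destruct k; [unfold y; simpl; rewrite Rabs_R0; auto|].
    assert (HT := abs_telescope Z P 1 (S k) ltac:(lia) (fun j Hj => HZ j ltac:(lia))).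
    assert (Z1 : Z 1%nat = 0) by (unfold Z, y, v; simpl; rewrite F1, q1; field; lra).
    rewrite Z1, Rminus_0_r in HT.
    assert (HP : P (S k) - P 1%nat <= Phi * (M / (alpha * alpha) + 4 / alpha)).
    { unfold P; rewrite <- Rmult_minus_distr_l; apply Rmult_le_compat_l; [auto|].
      destruct (tame_mesh_range x s N (S k) T Hk) as [R1 R2].
      destruct (tame_mesh_range x s N 1 T ltac:(lia)) as [R3 R4].
      destruct (Hs2 (S k)), (Hs2 1%nat); unfold Rdiv in *.
      nra. }
    assert (Hcq : Rabs (c (S k) * q (S k)) <= / alpha * Phi).
    { apply Rabs_mult_le; [|auto]. rewrite Rabs_pos_eq; [|left]; apply Hc; lia. }
    replace (y (S k)) with (Z (S k) + - (c (S k) * q (S k))) by (unfold Z; ring).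
    apply Rle_trans with (1 := Rabs_triang _ _); rewrite Rabs_Ropp.
    unfold K, Rdiv in *; nra. }
  assert (Hpi : forall k, (k < N)%nat -> pi k < pi (S k)).
  { intros k Hk; unfold pi; simpl.
    assert (0 < step x (S k) * p (S k)); [|lra].
    apply Rmult_lt_0_compat; [apply Hh|apply Hp]; lia. }
  assert (Hpi0 : forall k, (k <= N)%nat -> 0 <= pi k).
  { induction k as [|k IH]; intros Hk; [unfold pi; simpl; lra|].
    specialize (Hpi k ltac:(lia)); specialize (IH ltac:(lia)); lra. }
  assert (HpiN : forall k, (k <= N)%nat -> pi k <= pi N).
  { intros k Hk; assert (HkN : (k <= N <= N)%nat) by lia; revert HkN.
    generalize N at 1 2 4; intros n [Hkn HnN]; induction Hkn as [|n Hkn IH]; [lra|].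
    specialize (Hpi n ltac:(lia)); specialize (IH ltac:(lia)); lra. }
  assert (HN0 : 0 < pi N).
  { assert (H0 := Hpi 0%nat ltac:(lia)); assert (H1 := HpiN 1%nat ltac:(lia)).
    assert (H2 := Hpi0 0%nat ltac:(lia)); lra. }
  set (t := y N / pi N).
  exists (mesh_sum x (fun k => v k - t * p k)).
  assert (Elin : forall k, mesh_sum x (fun k => v k - t * p k) k = y k - t * pi k).
  { induction k as [|k IH]; unfold y, pi; simpl; [ring|]. rewrite IH; unfold y, pi; ring. }
  split; [reflexivity|split; [rewrite Elin; unfold t; field; lra|split]].
  - intros j Hj.
    assert (h1 := Hh j ltac:(lia)); assert (h2 := Hh (S j) ltac:(lia)).
    assert (Hb := Hhb j ltac:(lia)).
    assert (Eq := qS j ltac:(lia)); assert (Ep := pS j ltac:(lia)).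
    unfold delta2; rewrite Dplus_mesh_sum, Dminus_mesh_sum by (lia || lra).
    fold (hbar x j).
    replace (F (S j) - F j) with
      (eps * (v (S j) - v j) + rho j * (eps * v (S j))
        - t * eps * (p (S j) * (1 + rho j) - p j)).
    + unfold rho; field; lra.
    + unfold v; replace (eps * ((F (S j) + q (S j)) / eps - (F j + q j) / eps))
        with (F (S j) + q (S j) - F j - q j) by (field; lra).
      replace (eps * ((F (S j) + q (S j)) / eps)) with (F (S j) + q (S j)) by (field; lra).
      rewrite Ep; lra.
  - intros j Hj; rewrite Elin.
    replace (2 * (M / (alpha * alpha) + 5 / alpha) * Phi) with (K + K * 1) by (unfold K; ring).
    apply Rle_trans with (1 := Rabs_triang _ _); rewrite Rabs_Ropp.
    apply Rplus_le_compat; [auto|].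
    replace (t * pi j) with (y N * (pi j / pi N)) by (unfold t; field; lra).
    apply Rabs_mult_le; [auto|].
    rewrite Rabs_pos_eq; [apply Rle_div_l; [lra|rewrite Rmult_1_l; auto]|].
    apply Rdiv_le_0_compat; auto.
Qed.

(** * The truncation error as a difference of small fluxes *)

(** F is the sum of hbar_k times the truncation error. Up to errors of one cell,
    eps D^- u(x_j) is eps w(x_j), whose increment over a cell is the integral of
    g - a w. The quadrature hbar_j (g(x_j) - a(x_j) D^+ u(x_j)) differs from it by
    delta times the increment of V, which sums to O(delta), and by the jumps of the
    step size, which contribute delta each. *)
Lemma truncation_flux (x s : nat -> R) (N : nat) (delta eps M K G L : R)
    (V dV a u w g : R -> R) :
  tame_mesh x N s -> (2 <= N)%nat -> 0 < eps ->
  0 <= M -> 0 <= K -> 0 <= G -> 0 <= L ->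
  (forall t, is_derive V t (dV t)) -> (forall t, 1 <= dV t) -> V 1 - V 0 <= 3 ->
  (forall j, (1 <= j <= N)%nat -> V (x j) - V (x (pred j)) <= delta) ->
  C1_bounded M a -> continuous_on Icc01 u ->
  (forall t, Ioo01 t -> is_derive u t (w t)) ->
  (forall t, Ioo01 t -> is_derive w t ((g t - a t * w t) / eps)) ->
  (forall t, Ioo01 t -> Rabs (w t) <= K * dV t) ->
  (forall t, Icc01 t -> Rabs (g t) <= G) ->
  (forall p q, 0 <= p -> p <= q -> q <= 1 -> Rabs (g q - g p) <= L * (V q - V p)) ->
  let Y := fun j => u (x j) in
  exists F, F 1%nat = 0 /\
    (forall j, (1 <= j < N)%nat ->
       (F (S j) - F j) / hbar x j
       = eps * delta2 x Y j + a (x j) * Dplus x Y j - g (x j)) /\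
    (forall j, (1 <= j <= N)%nat ->
       Rabs (F j) <= (3 * (M * K + L) + 7 * (M * K + G)) * delta).
Proof.
  intros T HN He HM HK HG HL DV V1 V3 Hdel Ca Cu Du Dw Bw Bg Lg Y.
  assert (T' := T); destruct T' as [X0 [XN [Hh [Hs Hs2]]]].
  set (D := M * K + G); assert (HD : 0 <= D) by (unfold D; nra).
  assert (Vlen : forall p q, p <= q -> q - p <= V q - V p).
  { intros p q Hpq; now apply length_le_majorant with dV. }
  assert (HI : forall t, Ioo01 t -> Icc01 t) by (unfold Ioo01, Icc01; intros; lra).
  assert (Xr : forall j, (j <= N)%nat -> Icc01 (x j)) by (intros; eapply tame_mesh_range; eauto).
  assert (Xs : forall j, x (S j) = x j + step x (S j)) by (intros; unfold step; simpl; ring).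
  assert (Xi : forall j, (1 <= j <= N - 1)%nat -> Ioo01 (x j)).
  { intros j Hj; destruct j as [|j]; [lia|].
    destruct (Xr j ltac:(lia)), (Xr (S (S j)) ltac:(lia)).
    assert (h1 := Hh (S j) ltac:(lia)); assert (h2 := Hh (S (S j)) ltac:(lia)).
    rewrite (Xs (S j)) in *; rewrite (Xs j) in *; split; lra. }
  assert (Wvar : forall p q, Ioo01 p -> Ioo01 q -> p <= q ->
    Rabs (eps * w q - eps * w p) <= D * (V q - V p)).
  { intros p q Hp Hq Hpq; unfold Ioo01 in Hp, Hq.
    apply (increment_le_majorant D p q (fun t => eps * w t) (fun t => g t - a t * w t) V dV);
      auto.
    - apply is_derive_continuous_on with (fun t => eps * ((g t - a t * w t) / eps)).
      intros; apply is_derive_scal, Dw; unfold Ioo01; lra.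
    - intros t Ht; evar_last; [apply is_derive_scal, Dw; unfold Ioo01; lra|field; lra].
    - intros t Ht; assert (Ht' : Ioo01 t) by (unfold Ioo01; lra).
      apply Rle_trans with (1 := Rabs_triang _ _); rewrite Rabs_Ropp.
      assert (H1 := Rabs_mult_le _ _ _ _ (proj1 (proj2 Ca) t (HI t Ht')) (Bw t Ht')).
      assert (H2 := Bg t (HI t Ht')); specialize (V1 t); unfold D; nra. }
  assert (Uvar : forall p q, 0 <= p -> p <= q -> q <= 1 ->
    Rabs (u q - u p) <= K * (V q - V p)).
  { intros p q Hp Hpq Hq; apply (increment_le_majorant K p q u w V dV); auto.
    - now apply Icc01_subset_continuous.
    - intros; apply Du; unfold Ioo01; lra.
    - intros; apply Bw; unfold Ioo01; lra. }
  assert (Dmean : forall j, (1 <= j <= N)%nat ->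
    exists c, Ioo01 c /\ x (pred j) < c < x j /\ Defs.Dminus x Y j = w c).
  { intros j Hj; assert (h := Hh j Hj).
    destruct (Xr j ltac:(lia)), (Xr (pred j) ltac:(lia)).
    destruct (mean_value (x (pred j)) (x j) u w) as [c [Hc Ec]].
    - unfold step in h; lra.
    - apply Icc01_subset_continuous; auto.
    - intros; apply Du; unfold Ioo01; lra.
    - exists c; split; [unfold Ioo01; lra|split; [lra|]].
      unfold Defs.Dminus, Y; rewrite Ec; unfold step in *; field; lra. }
  assert (Hdel0 : 0 <= delta).
  { assert (H1 := Hdel 1%nat ltac:(lia)); simpl in H1; rewrite (Xs 0%nat) in H1.
    assert (h := Hh 1%nat ltac:(lia)).
    assert (H2 := Vlen (x 0%nat) (x 0%nat + step x 1) ltac:(lra)); lra. }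
  assert (Hhd : forall j, (1 <= j <= N)%nat -> step x j <= delta).
  { intros j Hj; apply Rle_trans with (2 := Hdel j Hj); apply Vlen.
    assert (h := Hh j Hj); unfold step in h; lra. }
  assert (HV : forall p q j, (1 <= j <= N)%nat -> x (pred j) <= p -> p <= q -> q <= x j ->
    V q - V p <= delta).
  { intros p q j Hj H1 H2 H3; apply Rle_trans with (2 := Hdel j Hj).
    assert (A1 := Vlen _ _ H1); assert (A3 := Vlen _ _ H3); lra. }
  set (load := fun j => a (x j) * Dplus x Y j - g (x j)).
  set (tr := fun j => eps * (Defs.Dminus x Y (S j) - Defs.Dminus x Y j) + hbar x j * load j).
  set (F := fun j => sum_n_m tr 1 (pred j) : R).
  assert (F1 : F 1%nat = 0) by (apply (sum_n_m_zero tr); lia).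
  assert (FS : forall j, (1 <= j)%nat -> F (S j) = F j + tr j).
  { intros j Hj; destruct j; [lia|]; unfold F; simpl; rewrite sum_n_Sm by lia; reflexivity. }
  assert (DpDm : forall j, Dplus x Y j = Defs.Dminus x Y (S j)) by reflexivity.
  assert (Hcell : forall j, (1 <= j < N)%nat -> step x (S j) * Rabs (load j) <= D * delta).
  { intros j Hj; assert (h := Hh (S j) ltac:(lia)).
    destruct (Xr j ltac:(lia)), (Xr (S j) ltac:(lia)).
    rewrite <- (Rabs_pos_eq (step x (S j))) by lra; rewrite <- Rabs_mult.
    replace (step x (S j) * load j)
      with (a (x j) * (u (x (S j)) - u (x j)) + - (step x (S j) * g (x j)))
      by (unfold load, Dplus, Y; field; lra).
    apply Rle_trans with (1 := Rabs_triang _ _); rewrite Rabs_Ropp.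
    assert (B1 : Rabs (u (x (S j)) - u (x j)) <= K * delta).
    { apply Rle_trans with (1 := Uvar (x j) (x (S j)) ltac:(lra) ltac:(rewrite Xs; lra) ltac:(lra)).
      apply Rmult_le_compat_l; [auto|apply (Hdel (S j)); lia]. }
    assert (B2 := Rabs_mult_le _ _ _ _ (proj1 (proj2 Ca) (x j) (Xr j ltac:(lia))) B1).
    assert (B3 : Rabs (step x (S j) * g (x j)) <= delta * G).
    { apply Rabs_mult_le; [rewrite Rabs_pos_eq by lra; apply Hhd; lia|apply Bg, Xr; lia]. }
    unfold D; lra. }
  (* the scheme weights with hbar_j what belongs to the cell of length h_(j+1) *)
  assert (Hjump : forall j, (1 <= j < N)%nat ->
    Rabs ((hbar x j - step x (S j)) * load j) <= / 2 * (s (S j) - s j) * (D * delta)).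
  { intros j Hj; assert (h := Hh (S j) ltac:(lia)); assert (Hsj := Hs j Hj).
    rewrite Rabs_mult.
    replace (hbar x j - step x (S j)) with (- (/ 2 * (step x (S j) - step x j)))
      by (unfold hbar; field).
    rewrite Rabs_Ropp, Rabs_mult, (Rabs_pos_eq (/ 2)) by lra.
    assert (H0 := Rabs_pos (step x (S j) - step x j)).
    assert (H0' := Rabs_pos (load j)); assert (Hc := Hcell j Hj).
    apply Rle_trans with (/ 2 * ((s (S j) - s j) * step x (S j)) * Rabs (load j)).
    - apply Rmult_le_compat_r; [auto|]; apply Rmult_le_compat_l; [lra|auto].
    - assert (0 <= s (S j) - s j).
      { apply Rmult_le_reg_r with (step x (S j)); lra. }
      replace (/ 2 * ((s (S j) - s j) * step x (S j)) * Rabs (load j))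
        with (/ 2 * (s (S j) - s j) * (step x (S j) * Rabs (load j))) by ring.
      apply Rmult_le_compat_l; [lra|auto]. }
  (* j + 1 < N here: w need not have a limit at the end point 1, so the last cell is
     treated separately through its mean value point *)
  assert (Hlocal : forall j, (1 <= j < N - 1)%nat ->
    Rabs (step x (S j) * load j + (eps * w (x (S j)) - eps * w (x j)))
      <= (M * K + L) * delta * (V (x (S j)) - V (x j))).
  { intros j Hj; assert (h := Hh (S j) ltac:(lia)).
    assert (I1 := Xi j ltac:(lia)); assert (I2 := Xi (S j) ltac:(lia)).
    unfold Ioo01 in I1, I2.
    set (phi := fun t => eps * w t + (a (x j) * u t + - g (x j) * t)).
    set (dphi := fun t => eps * ((g t - a t * w t) / eps) + (a (x j) * w t + - g (x j))).
    assert (Dphi : forall t, Ioo01 t -> is_derive phi t (dphi t)).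
    { intros t Ht; unfold phi, dphi.
      apply (is_derive_plus (fun t => eps * w t)); [now apply is_derive_scal, Dw|].
      apply (is_derive_plus (fun t => a (x j) * u t) (fun t => - g (x j) * t)).
      - now apply is_derive_scal, Du.
      - apply is_derive_linear. }
    replace (step x (S j) * load j + (eps * w (x (S j)) - eps * w (x j)))
      with (phi (x (S j)) - phi (x j))
      by (unfold phi, load, Dplus, Y; rewrite Xs at 3; field; lra).
    apply (increment_le_majorant ((M * K + L) * delta) (x j) (x (S j)) phi dphi V dV); auto.
    - rewrite Xs; lra.
    - apply is_derive_continuous_on with dphi; intros; apply Dphi; unfold Ioo01; lra.
    - intros; apply Dphi; unfold Ioo01; lra.
    - intros t Ht; assert (Ht' : Ioo01 t) by (unfold Ioo01; lra).
      replace (dphi t) with (- (a t - a (x j)) * w t + (g t - g (x j)))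
        by (unfold dphi; field; lra).
      assert (A1 := C1_bounded_lipschitz M a (x j) t Ca ltac:(lra) ltac:(lra) ltac:(lra)).
      assert (A2 := Lg (x j) t ltac:(lra) ltac:(lra) ltac:(lra)).
      assert (A3 : V t - V (x j) <= delta) by (apply (HV _ _ (S j)); simpl; lia || lra).
      assert (A4 := Vlen (x j) t ltac:(lra)).
      apply Rle_trans with (1 := Rabs_triang _ _).
      apply Rle_trans with (M * delta * (K * dV t) + L * delta).
      + apply Rplus_le_compat.
        * apply Rabs_mult_le; [|auto]; rewrite Rabs_Ropp.
          apply Rle_trans with (1 := A1), Rmult_le_compat_l; lra.
        * apply Rle_trans with (1 := A2), Rmult_le_compat_l; lra.
      + specialize (V1 t); assert (0 <= L * delta) by nra; nra. }
  assert (Hnode : forall j, (1 <= j <= N - 1)%nat ->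
    Rabs (eps * Defs.Dminus x Y j - eps * w (x j)) <= D * delta).
  { intros j Hj; destruct (Dmean j ltac:(lia)) as [c [Hc [Hc' ->]]].
    rewrite Rabs_minus_sym.
    apply Rle_trans with (1 := Wvar c (x j) Hc (Xi j Hj) ltac:(lra)).
    apply Rmult_le_compat_l; [auto|]; apply (HV _ _ j); lia || lra. }
  set (Z := fun j => F j - eps * Defs.Dminus x Y j + eps * w (x j)).
  set (P := fun j => (M * K + L) * delta * V (x j) + / 2 * D * delta * s j).
  assert (HZ : forall j, (1 <= j < N - 1)%nat -> Rabs (Z (S j) - Z j) <= P (S j) - P j).
  { intros j Hj.
    replace (Z (S j) - Z j) with
      ((step x (S j) * load j + (eps * w (x (S j)) - eps * w (x j)))
       + (hbar x j - step x (S j)) * load j)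
      by (unfold Z; rewrite FS by lia; unfold tr; ring).
    apply Rle_trans with (1 := Rabs_triang _ _).
    assert (H1 := Hlocal j Hj); assert (H2 := Hjump j ltac:(lia)).
    unfold P; lra. }
  assert (HMKL : 0 <= M * K + L) by nra.
  assert (HF : forall j, (1 <= j <= N - 1)%nat ->
    Rabs (F j) <= (3 * (M * K + L) + 3 * D) * delta).
  { intros j Hj.
    assert (HT := abs_telescope Z P 1 j ltac:(lia) (fun k Hk => HZ k ltac:(lia))).
    assert (HP : P j - P 1%nat <= (3 * (M * K + L) + D) * delta).
    { unfold P.
      assert (A1 : V (x j) - V (x 1%nat) <= 3).
      { assert (B1 := Vlen _ _ (proj2 (Xr j ltac:(lia)))).
        assert (B2 := Vlen _ _ (proj1 (Xr 1%nat ltac:(lia)))).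
        destruct (Xr j ltac:(lia)), (Xr 1%nat ltac:(lia)); lra. }
      destruct (Hs2 j), (Hs2 1%nat).
      assert (0 <= (M * K + L) * delta) by nra; assert (0 <= D * delta) by nra; nra. }
    assert (H1 := Hnode 1%nat ltac:(lia)); assert (H2 := Hnode j Hj).
    replace (F j) with ((Z j - Z 1%nat)
      + ((eps * Defs.Dminus x Y j - eps * w (x j))
         - (eps * Defs.Dminus x Y 1 - eps * w (x 1%nat)))) by (unfold Z; rewrite F1; ring).
    unfold Rminus at 2.
    apply Rle_trans with (1 := Rabs_triang _ _).
    assert (H3 := Rabs_triang (eps * Defs.Dminus x Y j - eps * w (x j))
      (- (eps * Defs.Dminus x Y 1 - eps * w (x 1%nat)))).
    rewrite Rabs_Ropp in H3; lra. }
  exists F; split; [exact F1|split].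
  - intros j Hj; rewrite FS by lia.
    assert (h1 := Hh j ltac:(lia)); assert (h2 := Hh (S j) ltac:(lia)).
    unfold tr, load, delta2; fold (hbar x j); rewrite DpDm.
    assert (0 < hbar x j) by (unfold hbar; lra).
    field; lra.
  - intros j Hj; destruct (Nat.eq_dec j N) as [->|HjN].
    2: { apply Rle_trans with (1 := HF j ltac:(lia)); apply Rmult_le_compat_r; unfold D in *; lra. }
    destruct N as [|n]; [lia|].
    replace (S n - 1)%nat with n in * by lia.
    rewrite FS by lia.
    apply Rle_trans with (1 := Rabs_triang _ _).
    assert (H1 := HF n ltac:(lia)).
    assert (H2 : Rabs (eps * (Defs.Dminus x Y (S n) - Defs.Dminus x Y n)) <= D * (2 * delta)).
    { destruct (Dmean (S n) ltac:(lia)) as [c [Hc [Hc' ->]]].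
      destruct (Dmean n ltac:(lia)) as [d [Hd [Hd' ->]]].
      simpl in Hc'; rewrite Rmult_minus_distr_l.
      apply Rle_trans with (1 := Wvar d c Hd Hc ltac:(lra)), Rmult_le_compat_l; [auto|].
      assert (A1 := HV d (x n) n ltac:(lia) ltac:(lra) ltac:(lra) ltac:(lra)).
      assert (A2 := HV (x n) c (S n) ltac:(lia) ltac:(simpl; lra) ltac:(lra) ltac:(lra)).
      lra. }
    assert (H3 : Rabs (hbar x n * load n) <= 2 * (D * delta)).
    { replace (hbar x n * load n)
        with (step x (S n) * load n + (hbar x n - step x (S n)) * load n) by ring.
      apply Rle_trans with (1 := Rabs_triang _ _).
      rewrite Rabs_mult, (Rabs_pos_eq (step x (S n))) by (left; apply Hh; lia).
      assert (A1 := Hcell n ltac:(lia)); assert (A2 := Hjump n ltac:(lia)).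
      destruct (Hs2 n), (Hs2 (S n)).
      assert (0 <= D * delta) by nra; nra. }
    assert (H4 : Rabs (tr n) <= 4 * (D * delta)).
    { unfold tr; apply Rle_trans with (1 := Rabs_triang _ _); lra. }
    unfold D in *; lra.
Qed.

(** * The layer majorant on the Shishkin mesh *)

Definition layer_function (alpha : R) (eps : index2 -> R) (t : R) : R :=
  t - exp (- (alpha * t / eps fst_ix)) - exp (- (alpha * t / eps snd_ix)).

Definition layer_density (alpha : R) (eps : index2 -> R) (t : R) : R :=
  1 + alpha / eps fst_ix * exp (- (alpha * t / eps fst_ix))
    + alpha / eps snd_ix * exp (- (alpha * t / eps snd_ix)).

Lemma is_derive_layer_function (alpha : R) (eps : index2 -> R) (t : R) :
  is_derive (layer_function alpha eps) t (layer_density alpha eps t).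
Proof.
  unfold layer_function, layer_density; auto_derive; [trivial|]. unfold Rdiv; ring.
Qed.

Lemma exp_opp_le_1 (p : R) : 0 <= p -> exp (- p) <= 1.
Proof.
  intros [H|<-]; [|rewrite Ropp_0, exp_0; lra].
  rewrite <- exp_0; left; apply exp_increasing; lra.
Qed.

Lemma exp_drop_le (p q : R) : 0 <= p -> p <= q -> exp (- p) - exp (- q) <= q - p.
Proof.
  intros Hp Hpq.
  replace (- q) with (- p + - (q - p)) by ring; rewrite exp_plus.
  assert (H1 := exp_opp_le_1 p Hp); assert (H2 := exp_pos (- p)).
  assert (H3 := exp_ineq1_le (- (q - p))).
  assert (H4 : 1 - exp (- (q - p)) <= q - p) by lra.
  assert (H5 := exp_opp_le_1 (q - p) ltac:(lra)).
  replace (exp (- p) - exp (- p) * exp (- (q - p)))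
    with (exp (- p) * (1 - exp (- (q - p)))) by ring.
  nra.
Qed.

(** Steps 1 to n, n + 1 to 2n and 2n + 1 to 4n are equal; the count goes up when the
    step number passes n and 2n. *)
Definition mesh_jumps (n j : nat) : R :=
  (if (j <=? n)%nat then 0 else 1) + (if (j <=? 2 * n)%nat then 0 else 1).

Ltac leb_cases :=
  repeat match goal with
  | |- context [(?p <=? ?q)%nat] => destruct (Nat.leb_spec p q); try lia
  end.

Lemma mesh_step (alpha : R) (eps : index2 -> R) (n j : nat) :
  let t1 := tau1 alpha eps (4 * n) in
  let t2 := tau2 alpha eps (4 * n) in
  (1 <= n)%nat -> (1 <= j)%nat ->
  step (mesh alpha eps (4 * n)) j
  = if (j <=? n)%nat then t1 / INR n
    else if (j <=? 2 * n)%nat then (t2 - t1) / INR n else (1 - t2) / (2 * INR n).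
Proof.
  intros t1 t2 Hn Hj; destruct j as [|j]; [lia|].
  assert (HR : 1 <= INR n) by (apply (le_INR 1); lia).
  unfold step, mesh; fold t1 t2.
  replace (INR (4 * n)) with (4 * INR n) by (rewrite mult_INR; simpl; ring).
  simpl pred; rewrite S_INR.
  leb_cases; try (replace (INR j) with (INR n) by (f_equal; lia));
    try (replace (INR j) with (2 * INR n)
           by (replace j with (2 * n)%nat by lia; rewrite mult_INR; simpl; ring));
    field; lra.
Qed.

Section ShishkinMesh.

Variables (alpha : R) (eps : index2 -> R) (n : nat).
Hypotheses (Halpha : 0 < alpha) (He1 : 0 < eps fst_ix)
  (He12 : eps fst_ix < eps snd_ix) (Hn : (1 <= n)%nat).

Let N := (4 * n)%nat.
Let x := mesh alpha eps N.
Let lam := ln (INR N).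
Let t1 := tau1 alpha eps N.
Let t2 := tau2 alpha eps N.

Lemma INR_n_ge1 : 1 <= INR n.
Proof. apply (le_INR 1); lia. Qed.

Lemma INR_N : INR N = 4 * INR n.
Proof. unfold N; rewrite mult_INR; simpl; ring. Qed.

Lemma ln_N_ge1 : 1 <= lam.
Proof.
  unfold lam; rewrite <- (ln_exp 1).
  assert (H := INR_n_ge1); assert (H3 := exp_le_3).
  apply ln_le; [apply exp_pos|rewrite INR_N; lra].
Qed.

Lemma tau2_cases :
  (t2 = 1 / 2 /\ 1 / 2 <= 2 * eps snd_ix / alpha * lam) \/
  (t2 = 2 * eps snd_ix / alpha * lam /\ 2 * eps snd_ix / alpha * lam <= 1 / 2).
Proof. unfold t2, tau2, Rmin; fold lam; destruct Rle_dec; [left|right]; split; lra. Qed.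

Lemma tau1_cases :
  (t1 = t2 / 2 /\ t2 / 2 <= 2 * eps fst_ix / alpha * lam) \/
  (t1 = 2 * eps fst_ix / alpha * lam /\ 2 * eps fst_ix / alpha * lam <= t2 / 2).
Proof. unfold t1, tau1, Rmin; fold t2 lam; destruct Rle_dec; [left|right]; split; lra. Qed.

Lemma tau_bounds : 0 < t1 /\ t1 <= t2 / 2 /\ 0 < t2 <= 1 / 2.
Proof.
  assert (Hl := ln_N_ge1).
  assert (Q : forall e, 0 < e -> 0 < 2 * e / alpha * lam).
  { intros e He; apply Rmult_lt_0_compat; [apply Rdiv_lt_0_compat|]; lra. }
  assert (Q1 := Q (eps fst_ix) ltac:(lra)); assert (Q2 := Q (eps snd_ix) ltac:(lra)).
  destruct tau1_cases, tau2_cases; lra.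
Qed.

Lemma shishkin_step_pos (j : nat) : (1 <= j <= N)%nat -> 0 < step x j.
Proof.
  intros Hj; unfold x, N; rewrite mesh_step by lia; fold N t1 t2.
  assert (H := INR_n_ge1); destruct tau_bounds as [? [? ?]].
  leb_cases; apply Rdiv_lt_0_compat; lra.
Qed.

(** At x_n the steps grow, since tau_1 <= tau_2 / 2. At x_(2n) they may shrink, but the
    steps after it are at least 1/N and those before it at most 2/N, so that
    |h_(2n+1) - h_(2n)| <= h_(2n+1). *)
Lemma shishkin_tame : tame_mesh x N (mesh_jumps n).
Proof.
  assert (H := INR_n_ge1); destruct tau_bounds as [T1 [T12 T2]].
  assert (HN := INR_N).
  split; [|split; [|split; [|split]]].
  - unfold x, mesh; simpl; ring.
  - unfold x, mesh; rewrite HN; unfold N; leb_cases; fold N t2; field; lra.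
  - apply shishkin_step_pos.
  - intros j Hj; unfold x, N, mesh_jumps; rewrite !mesh_step by lia; fold N t1 t2.
    assert (HI : 0 < / INR n) by (apply Rinv_0_lt_compat; lra).
    replace ((1 - t2) / (2 * INR n)) with ((1 - t2) / 2 / INR n) by (field; lra).
    assert (P1 : 0 <= t1 * / INR n) by (apply Rmult_le_pos; lra).
    assert (P2 : 0 <= (t2 - 2 * t1) * / INR n) by (apply Rmult_le_pos; lra).
    assert (P3 : 0 <= (1 - 2 * t2 + t1) * / INR n) by (apply Rmult_le_pos; lra).
    unfold Rdiv; leb_cases; apply Rabs_le_between; split; lra.
  - intros j; unfold mesh_jumps; leb_cases; lra.
Qed.

Lemma shishkin_node_n : x n = t1.
Proof.
  assert (H := INR_n_ge1); unfold x, mesh; fold t1; rewrite INR_N; unfold N.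
  leb_cases; field; lra.
Qed.

Lemma shishkin_node_2n : x (2 * n) = t2.
Proof.
  assert (H := INR_n_ge1); unfold x, mesh; fold t1 t2; rewrite INR_N; unfold N.
  rewrite mult_INR; simpl INR; leb_cases; field; lra.
Qed.

(** For each exponential either the step is at most a multiple of eps ln N / N, or the
    cell starts beyond (2 eps / alpha) ln N, where the exponential is already below
    1/N. Where tau_1 = tau_2 / 2 and tau_2 is not 1/2, the fast exponential is fine up
    to tau_2 because the step there is still the small one, and past tau_2 it is
    dominated by the slow one. The constant 26 is 2 + 8 + 16: the linear part of the
    majorant, the slow and the fast exponential. *)
Lemma shishkin_layer_increment (j : nat) :
  (1 <= j <= N)%nat ->
  layer_function alpha eps (x j) - layer_function alpha eps (x (pred j))
    <= 26 * (/ INR N * lam).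
Proof.
  intros Hj.
  assert (H := INR_n_ge1); assert (Hl := ln_N_ge1); assert (HN := INR_N).
  destruct tau_bounds as [T1 [T12 T2]].
  assert (T := shishkin_tame).
  assert (Hpos := shishkin_step_pos j Hj).
  assert (Hst : step x j = if (j <=? n)%nat then t1 / INR n
    else if (j <=? 2 * n)%nat then (t2 - t1) / INR n else (1 - t2) / (2 * INR n)).
  { unfold x, N; rewrite mesh_step by lia; reflexivity. }
  assert (Hx0 : 0 <= x (pred j)) by (eapply tame_mesh_range; [exact T|lia]).
  assert (L1 : (n < j)%nat -> t1 <= x (pred j)).
  { intros; rewrite <- shishkin_node_n; eapply tame_mesh_mono; [exact T|lia]. }
  assert (L2 : (2 * n < j)%nat -> t2 <= x (pred j)).
  { intros; rewrite <- shishkin_node_2n; eapply tame_mesh_mono; [exact T|lia]. }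
  set (q := / INR N * lam).
  assert (HI : 0 < / INR n) by (apply Rinv_0_lt_compat; lra).
  assert (EI : / INR N = / INR n / 4) by (rewrite HN; field; lra).
  assert (Hq : / INR n / 4 <= q) by (unfold q; rewrite EI; nra).
  assert (Hstep : step x j <= 2 * q).
  { apply Rle_trans with (/ INR n / 2); [|lra]; rewrite Hst.
    replace ((1 - t2) / (2 * INR n)) with ((1 - t2) / 2 / INR n) by (field; lra).
    unfold Rdiv at 1 2 4; destruct (j <=? n)%nat, (j <=? 2 * n)%nat; nra. }
  assert (Dfine : forall e, 0 < e -> forall B, alpha * step x j / e <= B ->
    exp (- (alpha * x (pred j) / e)) - exp (- (alpha * x j / e)) <= B).
  { intros e He B HB; apply Rle_trans with (2 := HB).
    replace (alpha * step x j / e) with (alpha * x j / e - alpha * x (pred j) / e)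
      by (unfold step; field; lra).
    apply exp_drop_le; [apply Rdiv_le_0_compat; nra|].
    apply Rmult_le_compat_r; [left; now apply Rinv_0_lt_compat|].
    unfold step in Hpos; nra. }
  assert (Dcoarse : forall e, 0 < e -> 2 * e / alpha * lam <= x (pred j) ->
    exp (- (alpha * x (pred j) / e)) - exp (- (alpha * x j / e)) <= q).
  { intros e He Hle.
    assert (A1 := exp_pos (- (alpha * x j / e))).
    assert (A2 : 2 * lam <= alpha * x (pred j) / e).
    { apply (Rle_div_r (2 * lam) _ e); [lra|].
      replace (2 * lam * e) with (alpha * (2 * e / alpha * lam)) by (field; lra).
      apply Rmult_le_compat_l; lra. }
    assert (A3 : exp (- (alpha * x (pred j) / e)) <= / INR N).
    { rewrite <- (exp_ln (INR N)) by lra; rewrite <- exp_Ropp; fold lam.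
      left; apply exp_increasing; lra. }
    lra. }
  (* a step below c * (2 e lam / alpha) / N resolves the e-layer *)
  assert (Hres : forall e c, 0 < e -> 0 <= c ->
    step x j * INR n <= c * (2 * e / alpha * lam) -> alpha * step x j / e <= 8 * c * q).
  { intros e c He Hc Hle; apply Rle_div_l; [lra|].
    apply Rmult_le_reg_r with (INR n); [lra|].
    replace (8 * c * q * e * INR n) with (alpha * (c * (2 * e / alpha * lam)))
      by (unfold q; rewrite EI; field; lra).
    rewrite Rmult_assoc; apply Rmult_le_compat_l; lra. }
  assert (HsR : step x j * INR n = if (j <=? n)%nat then t1
    else if (j <=? 2 * n)%nat then t2 - t1 else (1 - t2) / 2).
  { rewrite Hst; destruct (j <=? n)%nat, (j <=? 2 * n)%nat; field; lra. }
  assert (B2 : exp (- (alpha * x (pred j) / eps snd_ix))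
    - exp (- (alpha * x j / eps snd_ix)) <= 8 * 1 * q).
  { destruct tau2_cases as [[C1 C2]|[C1 C2]].
    - apply Dfine, Hres; try lra. rewrite HsR; leb_cases; lra.
    - destruct (Nat.le_gt_cases j (2 * n)) as [Hc|Hc].
      + apply Dfine, Hres; try lra. rewrite HsR; leb_cases; lra.
      + apply Rle_trans with q; [apply Dcoarse; [lra|]; specialize (L2 Hc); lra|lra]. }
  assert (B1 : exp (- (alpha * x (pred j) / eps fst_ix))
    - exp (- (alpha * x j / eps fst_ix)) <= 8 * 2 * q).
  { assert (Hlt : 2 * eps fst_ix / alpha * lam <= 2 * eps snd_ix / alpha * lam).
    { apply Rmult_le_compat_r; [lra|]; apply Rmult_le_compat_r; [|lra].
      left; now apply Rinv_0_lt_compat. }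
    destruct tau1_cases as [[C1 C2]|[C1 C2]].
    - destruct (Nat.le_gt_cases j (2 * n)) as [Hc|Hc].
      + apply Dfine, Hres; try lra. rewrite HsR; leb_cases; lra.
      + destruct tau2_cases as [[C3 C4]|[C3 C4]].
        * apply Dfine, Hres; try lra. rewrite HsR; leb_cases; lra.
        * apply Rle_trans with q; [apply Dcoarse; [lra|]; specialize (L2 Hc); lra|lra].
    - destruct (Nat.le_gt_cases j n) as [Hc|Hc].
      + apply Dfine, Hres; try lra. rewrite HsR; leb_cases; lra.
      + apply Rle_trans with q; [apply Dcoarse; [lra|]; specialize (L1 Hc); lra|lra]. }
  unfold layer_function; fold x; unfold step in Hstep; lra.
Qed.

End ShishkinMesh.

(** * The error of the coupled system *)

Definition reaction_force (b : index2 -> index2 -> R -> R) (f u : index2 -> R -> R)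
    (i : index2) (t : R) : R :=
  f i t + (b i i t * u i t - b i (other i) t * u (other i) t).

(** The constants below depend on alpha, beta and a common bound M for the data and
    their first derivatives only, which is what makes the final estimate uniform. *)
Definition sol_bound (beta M : R) : R := M + M / beta.
Definition force_bound (beta M : R) : R := M + 2 * (M * sol_bound beta M).
Definition layer_constant (alpha beta M : R) : R :=
  (force_bound beta M
   + 3 * (2 * sol_bound beta M + 3 * (M * sol_bound beta M) + force_bound beta M)) / alpha.
Definition force_slope (alpha beta M : R) : R :=
  force_bound beta M + 2 * (M * layer_constant alpha beta M).
Definition flux_constant (alpha beta M : R) : R :=
  let K := layer_constant alpha beta M in
  3 * (M * K + force_slope alpha beta M) + 7 * (M * K + force_bound beta M).
Definition stability_constant (alpha beta M : R) : R :=
  2 * (M / (alpha * alpha) + 5 / alpha) * (1 + 2 * M / beta).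

Lemma delta2_minus (x Y Z : nat -> R) (j : nat) :
  delta2 x (fun k => Y k - Z k) j = delta2 x Y j - delta2 x Z j.
Proof. unfold delta2, Dplus, Defs.Dminus, Rdiv; ring. Qed.

Lemma Dplus_minus (x Y Z : nat -> R) (j : nat) :
  Dplus x (fun k => Y k - Z k) j = Dplus x Y j - Dplus x Z j.
Proof. unfold Dplus, Rdiv; ring. Qed.

Lemma product_increment (M A D1 D2 p q p' q' : R) :
  Rabs p' <= M -> Rabs q <= A -> Rabs (p - p') <= D1 -> Rabs (q - q') <= D2 ->
  Rabs (p * q - p' * q') <= D1 * A + M * D2.
Proof.
  intros; replace (p * q - p' * q') with ((p - p') * q + p' * (q - q')) by ring.
  apply Rle_trans with (1 := Rabs_triang _ _); apply Rplus_le_compat; now apply Rabs_mult_le.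
Qed.

Section SystemError.

Variables (alpha beta M : R) (a : index2 -> R -> R) (b : index2 -> index2 -> R -> R)
  (f : index2 -> R -> R) (l r : index2 -> R).
Hypotheses (Halpha : 0 < alpha) (Hbeta : 0 < beta) (HM : 0 <= M)
  (Ca : forall i, C1_bounded M (a i)) (Cb : forall i j, C1_bounded M (b i j))
  (Cf : forall i, C1_bounded M (f i))
  (Hl : forall i, Rabs (l i) <= M) (Hr : forall i, Rabs (r i) <= M)
  (Ha : forall i x, Icc01 x -> alpha <= a i x)
  (Hb : forall i x, Icc01 x -> beta <= b i i x - b i (other i) x)
  (Ho : forall i x, Icc01 x -> 0 < b i (other i) x).

Variables (eps : index2 -> R) (u : index2 -> R -> R).
Hypotheses (He : forall i, 0 < eps i <= 1) (Hu : bvp_solution eps a b f l r u).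

Let M0 := sol_bound beta M.
Let G := force_bound beta M.
Let K := layer_constant alpha beta M.
Let L := force_slope alpha beta M.
Let V := layer_function alpha eps.
Let dV := layer_density alpha eps.
Let g := reaction_force b f u.

Lemma constants_nonneg : 0 <= M0 /\ 0 <= G /\ 0 <= K /\ 0 <= L.
Proof.
  assert (H0 : 0 <= M0).
  { unfold M0, sol_bound; assert (0 <= M / beta) by (apply Rdiv_le_0_compat; lra); lra. }
  assert (HG : 0 <= G) by (unfold G, force_bound; fold M0; nra).
  assert (HK : 0 <= K).
  { unfold K, layer_constant; fold M0 G; apply Rdiv_le_0_compat; nra. }
  repeat split; auto. unfold L, force_slope; fold G K; nra.
Qed.

Lemma solution_bound (i : index2) (x : R) : Icc01 x -> Rabs (u i x) <= M0.
Proof.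
  intros Hx; unfold M0, sol_bound.
  apply (bvp_solution_bound beta M M eps a b f l r u); auto.
  - intros; apply He.
  - intros k y Hy; now apply Cf.
Qed.

Lemma force_le (i : index2) (x : R) : Icc01 x -> Rabs (g i x) <= G.
Proof.
  intros Hx; unfold g, reaction_force.
  assert (B1 := Rabs_mult_le _ _ _ _ (proj1 (proj2 (Cb i i)) x Hx) (solution_bound i x Hx)).
  assert (B2 := Rabs_mult_le _ _ _ _ (proj1 (proj2 (Cb i (other i))) x Hx)
    (solution_bound (other i) x Hx)).
  assert (B3 := proj1 (proj2 (Cf i)) x Hx).
  unfold G, force_bound; fold M0.
  apply Rabs_le_between in B1, B2, B3; apply Rabs_le_between; lra.
Qed.

Lemma solution_derive (i : index2) (x : R) :
  Ioo01 x -> is_derive (u i) x (Derive (u i) x).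
Proof. intros Hx; apply Derive_correct; exact (proj1 (proj1 (proj2 Hu) i x Hx)). Qed.

Lemma solution_derive2 (i : index2) (x : R) :
  Ioo01 x ->
  is_derive (Derive (u i)) x ((g i x - a i x * Derive (u i) x) / eps i).
Proof.
  intros Hx; destruct Hu as [_ [Du [Eq _]]].
  replace ((g i x - a i x * Derive (u i) x) / eps i) with (Derive_n (u i) 2 x).
  - apply Derive_correct; exact (proj2 (Du i x Hx)).
  - specialize (Eq i x Hx); unfold opL in Eq; rewrite !mulmv_diag, mulmv_matB in Eq.
    unfold g, reaction_force; rewrite <- Eq; field; apply Rgt_not_eq, He.
Qed.

Lemma layer_density_ge (i : index2) (t : R) :
  1 <= dV t /\ 1 + alpha / eps i * exp (- (alpha * t / eps i)) <= dV t.
Proof.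
  assert (H : forall k, 0 <= alpha / eps k * exp (- (alpha * t / eps k))).
  { intros k; apply Rmult_le_pos; [|left; apply exp_pos].
    apply Rdiv_le_0_compat; [lra|apply He]. }
  assert (H1 := H fst_ix); assert (H2 := H snd_ix).
  unfold dV, layer_density; destruct i; lra.
Qed.

(** The crude bound on the flux is fed into the comparison argument, and the
    exponential of component i is one of the two terms of the layer density. *)
Lemma solution_layer (i : index2) (x : R) :
  Ioo01 x -> Rabs (Derive (u i) x) <= K * dV x.
Proof.
  intros Hx; destruct constants_nonneg as [H0 [HG [HK _]]].
  assert (HI : forall t, Ioo01 t -> Icc01 t) by (unfold Ioo01, Icc01; intros; lra).
  set (W0 := 2 * M0 + 3 * (M * M0) + G).
  assert (HW : 0 <= W0) by (unfold W0; nra).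
  assert (B := layer_bound (eps i) alpha G W0 (a i) (g i) (Derive (u i))
    (proj1 (He i)) Halpha HG HW (fun t Ht => Ha i t (HI t Ht)) (solution_derive2 i)
    (fun t Ht => force_le i t (HI t Ht))).
  eapply Rle_trans; [apply B; [|exact Hx]|].
  - apply (flux_bound (eps i) M M0 G (a i) (g i) (u i)); auto using solution_derive,
      solution_derive2, solution_bound, force_le. apply Hu.
  - set (E := exp (- (alpha * x / eps i))).
    apply Rle_trans with (K * (1 + alpha / eps i * E)).
    2: { apply Rmult_le_compat_l; [auto|]. apply (layer_density_ge i x). }
    unfold K, layer_constant; fold M0 G W0.
    assert (HE : 0 < E) by apply exp_pos; destruct (He i) as [Hi _].
    replace ((G + 3 * W0) / alpha * (1 + alpha / eps i * E))
      with (G / alpha + 3 * W0 / eps i * E + (3 * W0 / alpha + G * (/ eps i * E)))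
      by (field; lra).
    assert (0 <= 3 * W0 / alpha) by (apply Rdiv_le_0_compat; lra).
    assert (0 < / eps i) by now apply Rinv_0_lt_compat.
    assert (0 <= G * (/ eps i * E)) by (apply Rmult_le_pos; nra). lra.
Qed.

Lemma layer_function_ge (p q : R) : p <= q -> q - p <= V q - V p.
Proof.
  intros Hpq; apply length_le_majorant with dV; auto.
  - intros; apply is_derive_layer_function.
  - intros; apply (layer_density_ge fst_ix).
Qed.

Lemma solution_increment (i : index2) (p q : R) :
  0 <= p -> p <= q -> q <= 1 -> Rabs (u i q - u i p) <= K * (V q - V p).
Proof.
  intros Hp Hpq Hq.
  apply (increment_le_majorant K p q (u i) (Derive (u i)) V dV); auto.
  - apply Icc01_subset_continuous; auto; apply Hu.
  - intros; apply is_derive_layer_function.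
  - intros; apply solution_derive; unfold Ioo01; lra.
  - intros; apply solution_layer; unfold Ioo01; lra.
Qed.

Lemma force_increment (i : index2) (p q : R) :
  0 <= p -> p <= q -> q <= 1 -> Rabs (g i q - g i p) <= L * (V q - V p).
Proof.
  intros Hp Hpq Hq; destruct constants_nonneg as [H0 [HG [HK _]]].
  assert (HV := layer_function_ge p q Hpq).
  assert (Ip : Icc01 p) by (split; lra); assert (Iq : Icc01 q) by (split; lra).
  assert (Bf := C1_bounded_lipschitz M (f i) p q (Cf i) Hp Hpq Hq).
  assert (Bb : forall j, Rabs (b i j q * u j q - b i j p * u j p)
    <= M * (q - p) * M0 + M * (K * (V q - V p))).
  { intros j; apply product_increment.
    - now apply Cb.
    - now apply solution_bound.
    - now apply C1_bounded_lipschitz.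
    - now apply solution_increment. }
  assert (B1 := Bb i); assert (B2 := Bb (other i)).
  assert (M * (q - p) <= M * (V q - V p)) by (apply Rmult_le_compat_l; lra).
  assert (M0 * M * (q - p) <= M0 * M * (V q - V p)) by (apply Rmult_le_compat_l; nra).
  unfold L, force_slope, force_bound; fold M0 K.
  unfold g, reaction_force; apply Rabs_le_between in Bf, B1, B2; apply Rabs_le_between; lra.
Qed.

Variables (x s : nat -> R) (N : nat) (delta : R) (U : index2 -> nat -> R).
Hypotheses (T : tame_mesh x N s) (HN : (2 <= N)%nat)
  (Hdelta : forall j, (1 <= j <= N)%nat -> V (x j) - V (x (pred j)) <= delta)
  (HU : discrete_solution x N eps a b f l r U).

Lemma layer_function_total : V 1 - V 0 <= 3.
Proof.
  unfold V, layer_function.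
  assert (H : forall k, exp (- (alpha * 0 / eps k)) = 1).
  { intros k; rewrite <- exp_0; f_equal; unfold Rdiv; ring. }
  rewrite !H.
  assert (H1 := exp_pos (- (alpha * 1 / eps fst_ix))).
  assert (H2 := exp_pos (- (alpha * 1 / eps snd_ix))); lra.
Qed.

Lemma delta_nonneg : 0 <= delta.
Proof.
  apply Rle_trans with (2 := Hdelta 1%nat ltac:(lia)); simpl.
  assert (h := proj1 (proj2 (proj2 T)) 1%nat ltac:(lia)); unfold step in h; simpl in h.
  assert (H := layer_function_ge (x 0%nat) (x 1%nat) ltac:(lra)); lra.
Qed.

Let Kpsi := 2 * (M / (alpha * alpha) + 5 / alpha) * (flux_constant alpha beta M * delta).

(** The discrete operator applied to the error is exactly the truncation error of the
    convective part: f and the reaction term cancel against the scheme at the nodes. *)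
Lemma convective_error (i : index2) :
  exists psi, psi 0%nat = 0 /\ psi N = 0 /\
    (forall j, (1 <= j < N)%nat ->
       eps i * delta2 x psi j + a i (x j) * Dplus x psi j
       = opLN x eps a b (fun k n => u k (x n) - U k n) j i) /\
    (forall j, (j <= N)%nat -> Rabs (psi j) <= Kpsi).
Proof.
  destruct constants_nonneg as [H0 [HG [HK HL]]].
  assert (Hd := delta_nonneg).
  destruct (truncation_flux x s N delta (eps i) M K G L V dV (a i) (u i) (Derive (u i)) (g i))
    as [F [F1 [FE FB]]];
    auto using solution_derive, solution_derive2, solution_layer, force_le, force_increment,
      layer_function_total.
  { apply He. }
  { intros; apply is_derive_layer_function. }
  { intros; apply (layer_density_ge i). }
  { apply Hu. }
  destruct (flux_stability x s N (eps i) alpha M (flux_constant alpha beta M * delta)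
    (fun j => a i (x j)) F) as [psi [P0 [PN [PE PB]]]]; auto.
  { apply He. }
  { apply Rmult_le_pos; [|auto]. unfold flux_constant; fold K L G; nra. }
  { intros j Hj; apply Ha; eapply tame_mesh_range; eauto. }
  { intros j Hj; destruct (tame_mesh_range x s N j T ltac:(lia)).
    destruct (tame_mesh_range x s N (S j) T ltac:(lia)).
    replace (step x (S j)) with (x (S j) - x j) by reflexivity.
    apply C1_bounded_lipschitz; auto.
    assert (h := proj1 (proj2 (proj2 T)) (S j) ltac:(lia)); unfold step in h; simpl in h; lra. }
  exists psi; repeat split; auto.
  intros j Hj; rewrite PE, FE by auto.
  assert (HUj := proj1 HU i j ltac:(lia)); unfold opLN in *.
  rewrite !mulmv_diag, !mulmv_matB in *; rewrite delta2_minus, Dplus_minus.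
  unfold g, reaction_force; rewrite <- HUj; ring.
Qed.

(** The remainder u - U - psi is mapped to B psi by the discrete operator, and vanishes
    at both ends. *)
Lemma system_error (i : index2) (j : nat) :
  (j <= N)%nat ->
  Rabs (u i (x j) - U i j)
    <= stability_constant alpha beta M * flux_constant alpha beta M * delta.
Proof.
  intros Hj.
  destruct (convective_error fst_ix) as [p1 [P10 [P1N [P1E P1B]]]].
  destruct (convective_error snd_ix) as [p2 [P20 [P2N [P2E P2B]]]].
  set (psi := fun k => match k with fst_ix => p1 | snd_ix => p2 end).
  assert (PE : forall k n, (1 <= n < N)%nat ->
    eps k * delta2 x (psi k) n + a k (x n) * Dplus x (psi k) n
    = opLN x eps a b (fun k n => u k (x n) - U k n) n k) by (intros [|]; auto).
  assert (PB : forall k n, (n <= N)%nat -> Rabs (psi k n) <= Kpsi) by (intros [|]; auto).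
  assert (HK0 : 0 <= Kpsi) by (apply Rle_trans with (2 := PB fst_ix 0%nat ltac:(lia)), Rabs_pos).
  assert (Xr : forall n, (n <= N)%nat -> Icc01 (x n)) by (intros; eapply tame_mesh_range; eauto).
  assert (Hth : forall k n, (n <= N)%nat ->
    Rabs (u k (x n) - U k n - psi k n) <= 2 * M * Kpsi / beta).
  { apply (discrete_max_principle beta (2 * M * Kpsi) x N eps a b
      (fun k n => u k (x n) - U k n - psi k n)); auto; try (intros; apply He).
    - nra.
    - apply T.
    - intros k n Hn; specialize (Ha k (x n) (Xr n Hn)); lra.
    - intros k n Hn.
      replace (opLN x eps a b (fun k n => u k (x n) - U k n - psi k n) n k)
        with (mulmv (matB b (x n)) (fun k => psi k n) k).
      + rewrite mulmv_matB.
        assert (B1 := Rabs_mult_le _ _ _ _ (proj1 (proj2 (Cb k k)) (x n) (Xr n ltac:(lia)))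
          (PB k n ltac:(lia))).
        assert (B2 := Rabs_mult_le _ _ _ _ (proj1 (proj2 (Cb k (other k))) (x n)
          (Xr n ltac:(lia))) (PB (other k) n ltac:(lia))).
        apply Rle_trans with (1 := Rabs_triang _ _); rewrite Rabs_Ropp; lra.
      + assert (E := PE k n ltac:(lia)); unfold opLN in *.
        rewrite !mulmv_diag, !mulmv_matB in *.
        rewrite (delta2_minus x (fun n => u k (x n) - U k n) (psi k)).
        rewrite (Dplus_minus x (fun n => u k (x n) - U k n) (psi k)).
        lra.
    - destruct Hu as [_ [_ [_ [U0 _]]]], HU as [_ [V0 _]], T as [X0 _].
      intros k; rewrite X0, U0, V0; destruct k; simpl; [rewrite P10|rewrite P20]; ring.
    - destruct Hu as [_ [_ [_ [_ U1]]]], HU as [_ [_ V1]], T as [_ [X1 _]].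
      intros k; rewrite X1, U1, V1; destruct k; simpl; [rewrite P1N|rewrite P2N]; ring. }
  specialize (Hth i j Hj); specialize (PB i j Hj).
  replace (stability_constant alpha beta M * flux_constant alpha beta M * delta)
    with (2 * M * Kpsi / beta + Kpsi)
    by (unfold stability_constant, Kpsi; field; lra).
  replace (u i (x j) - U i j) with ((u i (x j) - U i j - psi i j) + psi i j) by ring.
  apply Rle_trans with (1 := Rabs_triang _ _); lra.
Qed.

End SystemError.

Lemma uniform_bound2 (P : R -> index2 -> Prop) :
  (forall M M' i, M <= M' -> P M i -> P M' i) ->
  (forall i, exists M, P M i) -> exists M, forall i, P M i.
Proof.
  intros Hmono H; destruct (H fst_ix) as [M1 H1], (H snd_ix) as [M2 H2].
  exists (Rmax M1 M2); intros [|].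
  - apply Hmono with (2 := H1), Rmax_l.
  - apply Hmono with (2 := H2), Rmax_r.
Qed.

Lemma Rmax_N_le (h : nat -> R) (N : nat) (B : R) :
  (forall j, (j <= N)%nat -> h j <= B) -> Rmax_N h N <= B.
Proof.
  induction N as [|N IH]; intros H; simpl; [apply H; lia|].
  apply Rmax_lub; [apply H; lia|apply IH; intros; apply H; lia].
Qed.

Theorem theorem5p6 :
  exists k : nat,
  forall (alpha beta : R) (a : index2 -> R -> R) (b : index2 -> index2 -> R -> R)
    (f : index2 -> R -> R) (l r : index2 -> R),
  0 < alpha -> 0 < beta ->
  (forall i, Ck_Icc01 k (a i)) ->
  (forall i j, Ck_Icc01 k (b i j)) ->
  (forall i, Ck_Icc01 k (f i)) ->
  (forall i x, Icc01 x -> alpha <= a i x) ->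
  (forall i x, Icc01 x -> beta <= b i i x - b i (other i) x) ->
  (forall i x, Icc01 x -> 0 < b i (other i) x) ->
  exists C : R, 0 < C /\
  forall (eps : index2 -> R) (N : nat) (u : index2 -> R -> R) (U : index2 -> nat -> R),
  0 < eps fst_ix -> eps fst_ix < eps snd_ix -> eps snd_ix <= 1 ->
  (0 < N)%nat -> Nat.divide 4 N ->
  bvp_solution eps a b f l r u ->
  discrete_solution (mesh alpha eps N) N eps a b f l r U ->
  mesh_norm N (fun i j => u i (mesh alpha eps N j) - U i j)
    <= C * / INR N * ln (INR N).
Proof.
  (* one derivative of the data provides all the Lipschitz bounds *)
  exists 1%nat; intros alpha beta a b f l r Halpha Hbeta Ca Cb Cf Ha Hb Ho.
  assert (HM : exists M, 0 <= M /\ forall i, C1_bounded M (a i) /\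
    (forall j, C1_bounded M (b i j)) /\ C1_bounded M (f i) /\
    Rabs (l i) <= M /\ Rabs (r i) <= M).
  { destruct (uniform_bound2 (fun M i => C1_bounded M (a i) /\
      (forall j, C1_bounded M (b i j)) /\ C1_bounded M (f i) /\
      Rabs (l i) <= M /\ Rabs (r i) <= M)) as [M HM].
    - intros M M' i HMM [H1 [H2 [H3 [H4 H5]]]]; repeat split;
        try (now apply (C1_bounded_le M M')); lra || (intros; now apply (C1_bounded_le M M')).
    - intros i; destruct (Ck_C1_bounded _ (Ca i)) as [M1 H1].
      destruct (uniform_bound2 (fun M j => C1_bounded M (b i j))) as [M2 H2].
      { intros; eapply C1_bounded_le; eauto. }
      { intros j; now apply Ck_C1_bounded. }
      destruct (Ck_C1_bounded _ (Cf i)) as [M3 H3].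
      exists (Rmax (Rmax M1 M2) (Rmax M3 (Rmax (Rabs (l i)) (Rabs (r i))))).
      assert (A1 := Rmax_l (Rmax M1 M2) (Rmax M3 (Rmax (Rabs (l i)) (Rabs (r i))))).
      assert (A2 := Rmax_r (Rmax M1 M2) (Rmax M3 (Rmax (Rabs (l i)) (Rabs (r i))))).
      assert (A3 := Rmax_l M1 M2); assert (A4 := Rmax_r M1 M2).
      assert (A5 := Rmax_l M3 (Rmax (Rabs (l i)) (Rabs (r i)))).
      assert (A6 := Rmax_r M3 (Rmax (Rabs (l i)) (Rabs (r i)))).
      assert (A7 := Rmax_l (Rabs (l i)) (Rabs (r i))).
      assert (A8 := Rmax_r (Rabs (l i)) (Rabs (r i))).
      split; [|split; [intros j|split; [|split]]]; try lra.
      + apply C1_bounded_le with (2 := H1); lra.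
      + apply C1_bounded_le with (2 := H2 j); lra.
      + apply C1_bounded_le with (2 := H3); lra.
    - exists M; split; [|exact HM].
      apply Rle_trans with (Rabs (l fst_ix)); [apply Rabs_pos|apply HM]. }
  destruct HM as [M [HM0 HM]].
  set (c := stability_constant alpha beta M * flux_constant alpha beta M).
  (* the added 1 makes the constant positive *)
  exists (Rabs c * 26 + 1); split; [assert (H := Rabs_pos c); lra|].
  intros eps N u U He1 He12 He2 HN0 [n ->] Hu HU.
  rewrite Nat.mul_comm in *.
  assert (Hn : (1 <= n)%nat) by lia.
  assert (T := shishkin_tame alpha eps n Halpha He1 He12 Hn).
  assert (Hln := ln_N_ge1 n Hn).
  assert (HI : 0 < / INR (4 * n)).
  { apply Rinv_0_lt_compat; rewrite (INR_N n); assert (H := INR_n_ge1 n Hn); lra. }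
  assert (Hq : 0 <= / INR (4 * n) * ln (INR (4 * n))) by (apply Rmult_le_pos; lra).
  assert (Herr : forall i j, (j <= 4 * n)%nat ->
    Rabs (u i (mesh alpha eps (4 * n) j) - U i j)
      <= (Rabs c * 26 + 1) * / INR (4 * n) * ln (INR (4 * n))).
  { intros i j Hj.
    apply Rle_trans with (c * (26 * (/ INR (4 * n) * ln (INR (4 * n))))).
    - apply (system_error alpha beta M a b f l r Halpha Hbeta HM0) with eps (mesh_jumps n) (4 * n)%nat;
        auto; try (intros; apply HM); try lia.
      + intros [|]; lra.
      + intros; now apply shishkin_layer_increment.
    - assert (H := Rle_abs c); nra. }
  unfold mesh_norm; apply Rmax_lub; apply Rmax_N_le; intros; now apply Herr.
Qed.
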